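(* Let $n\ge 1$, $d=2^n$, let $|z\rangle\in\mathbb{C}^d$ be a unit vector and let $\mathcal{M}=\mathcal{M}_{C,z}$ be the Clifford POVM generated by $|z\rangle$. Then for every nonzero Hermitian $X\in\mathbb{C}^{d\times d}$, $$\|\mathcal{M}(X)\|_{\ell_1}\ \ge\ \frac{\|X\|_1}{\sqrt{\big(6\,d\,\alpha(z)\,r_{\mathrm{eff}}(X)+10\big)\,r_{\mathrm{eff}}(X)}},$$ where $r_{\mathrm{eff}}(X)=\|X\|_1^2/\|X\|_2^2$.
   Context: $d=2^n$. The Pauli operators $W_1=\mathbb{I},W_2,\dots,W_{d^2}$ are all $n$-fold tensor products $\sigma_{k_1}\otimes\cdots\otimes\sigma_{k_n}$ with $\sigma_0=\mathbb{I}$ and $\sigma_1,\sigma_2,\sigma_3$ the single-qubit Pauli matrices; the Pauli group is $\{\pm W_k,\pm iW_k\}$. The Clifford group $\mathrm{C}_n$ is the group of unitaries $U$ on $\mathbb{C}^d$ with $UPU^\dagger$ in the Pauli group for every element $P$ of the Pauli group. For a unit vector $|z\rangle$, let $\{|x_1\rangle\langle x_1|,\dots,|x_N\rangle\langle x_N|\}$ be the set of distinct projectors in the orbit $\{U|z\rangle\langle z|U^\dagger: U\in\mathrm{C}_n\}$; the Clifford POVM $\mathcal{M}_{C,z}$ has elements $M_k=\frac{d}{N}|x_k\rangle\langle x_k|$, $k=1,\dots,N$. For a POVM $\{M_k\}_{k=1}^N$ and Hermitian $X$, $\mathcal{M}(X)=(\mathrm{tr}(M_kX))_{k=1}^N\in\mathbb{R}^N$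 and $\|\cdot\|_{\ell_1}$ is the vector $\ell_1$-norm. $\|X\|_p$ denotes the Schatten $p$-norm. $\alpha(z)=\frac{1}{d^2}\sum_{k=1}^{d^2}\langle z|W_k|z\rangle^4$. *)

(* Defs.v *)
(* Complex numbers are modelled by an arbitrary
   numClosedFieldType C (e.g. the complex numbers). *)
From HB Require Import structures.
From mathcomp Require Import all_boot all_order all_algebra.
Set Implicit Arguments. Unset Strict Implicit. Unset Printing Implicit Defensive.
Import Order.TTheory GRing.Theory Num.Theory.
Local Open Scope ring_scope.

Section Defs.
Variable C : numClosedFieldType.

Definition adj {m k : nat} (A : 'M[C]_(m, k)) : 'M[C]_(k, m) := (map_mx Num.conj A)^T.

Definition sigma (k : 'I_4) (r c : bool) : C :=
  match nat_of_ord k with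
  | 0%N => if r == c then 1 else 0
  | 1%N => if r == c then 0 else 1
  | 2%N => if r == c then 0 else (if r then 'i else - 'i)
  | _ => if r == c then (if r then -1 else 1) else 0
  end.

(* l-th bit of the basis index i (tensor factor l) *)
Definition bit (i l : nat) : bool := odd (i %/ 2 ^ l).

(* Pauli operator sigma_{k_1} (x) ... (x) sigma_{k_n}, entries written out *)
Definition pauli (n : nat) (k : {ffun 'I_n -> 'I_4}) : 'M[C]_(2 ^ n) :=
  \matrix_(i, j) \prod_(l < n) sigma (k l) (bit i l) (bit j l).

Definition in_pauli_group (n : nat) (P : 'M[C]_(2 ^ n)) : Prop :=
  exists (c : C) (k : {ffun 'I_n -> 'I_4}),
    (c = 1 \/ c = -1 \/ c = 'i \/ c = - 'i) /\ P = c *: pauli k.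

Definition unitary (n : nat) (U : 'M[C]_(2 ^ n)) : Prop :=
  U *m adj U = 1%:M /\ adj U *m U = 1%:M.

Definition clifford (n : nat) (U : 'M[C]_(2 ^ n)) : Prop :=
  unitary U /\
  forall P, in_pauli_group P -> in_pauli_group (U *m P *m adj U).

Definition proj {m : nat} (z : 'cV[C]_m) : 'M[C]_m := z *m adj z.

Definition clifford_orbit_enum (n : nat) (z : 'cV[C]_(2 ^ n))
    (s : seq 'M[C]_(2 ^ n)) : Prop :=
  uniq s /\ forall P, P \in s <-> exists U, clifford U /\ P = U *m proj z *m adj U.

(* ell_1 norm of the outcome vector M(X) of the Clifford POVM whose elements
   are (d/N)|x_k><x_k| for the enumeration s = (|x_k><x_k|)_k, N = size s *)
Definition povm_l1 (n : nat) (s : seq 'M[C]_(2 ^ n)) (X : 'M[C]_(2 ^ n)) : C :=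
  \sum_(M <- s) `| \tr (((2 ^ n)%:R / (size s)%:R) *: M *m X) |.

Definition eigenvalues {m : nat} (A : 'M[C]_m) : seq C :=
  sval (closed_field_poly_normal (char_poly A)).

Definition singular_values {m : nat} (X : 'M[C]_m) : seq C :=
  [seq sqrtC e | e <- eigenvalues (adj X *m X)].

Definition schatten1 {m : nat} (X : 'M[C]_m) : C := \sum_(s <- singular_values X) s.
Definition schatten2 {m : nat} (X : 'M[C]_m) : C :=
  sqrtC (\sum_(s <- singular_values X) s ^+ 2).

Definition r_eff {m : nat} (X : 'M[C]_m) : C := schatten1 X ^+ 2 / schatten2 X ^+ 2.

Definition alpha (n : nat) (z : 'cV[C]_(2 ^ n)) : C :=
  ((2 ^ n)%:R ^+ 2)^-1 * \sum_(k : {ffun 'I_n -> 'I_4}) (adj z *m pauli k *m z) 0 0 ^+ 4.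

End Defs.

(* Main.v *)
Require Import Defs.
From HB Require Import structures.
From mathcomp Require Import all_boot all_order all_algebra.
From mathcomp Require Import ring.
From mathcomp Require boolp.
Set Implicit Arguments. Unset Strict Implicit. Unset Printing Implicit Defensive.
Import Order.TTheory GRing.Theory Num.Theory.
Local Open Scope ring_scope.

(** Write S = tr(P X) for P uniform on the orbit.  Berger's inequality
    E|S| >= (E S^2)^(3/2) / (E S^4)^(1/2) reduces the bound to the second moment, which
    is that of a 2-design, and to an upper bound on E S^4.

    With W_g the Paulis, chi(a,b) = +-1 their commutation signs and
    f_c,g(A) = tr(W_g A) tr(W_g W_c A), one has d^2 S^2 = sum_(c,g) f_c,g(X)^* f_c,g(P), and
    invariance of the orbit under Paulis makes different c uncorrelated.  For fixed c the
    covariance matrix (E f_c,g(P) f_c,h(P)^* )_(g,h) is invariant under the Clifford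
    transvections (1 + i W_w)/sqrt 2 with w commuting with c, which act on labels with
    Witt-type transitivity, and rank one of P (Fierz) makes it fixed by the Fourier
    transform F = (chi(g,h)/d)_(g,h).  These two properties determine it in terms of
    alpha(z): it is a combination of (1 + F) restricted to a symmetry class and of one
    rank-one matrix.  As F <= 1, the quadratic form is bounded by sum_g tr(W_g X)^4,
    (tr X^2)^2 and tr (tr(X) X + X^2)^2, and finally |tr(W_g X)| <= ||X||_1. *)

(** * Binary digits of a basis index as its tensor coordinates *)

Section BinaryDigits.

Lemma bitS (i l : nat) : bit i l.+1 = bit i./2 l.
Proof. by rewrite /bit expnS divnMA divn2. Qed.

Lemma bit_inj (n i j : nat) : (i < 2 ^ n)%N -> (j < 2 ^ n)%N ->
  (forall l, (l < n)%N -> bit i l = bit j l) -> i = j.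
Proof.
elim: n i j => [|n IH] i j; first by rewrite expn0 !ltnS !leqn0 => /eqP-> /eqP->.
rewrite expnS mul2n => hi hj hb.
rewrite -(odd_double_half i) -(odd_double_half j); congr (_ + _.*2)%N.
  by have := hb 0%N isT; rewrite /bit !expn0 !divn1 => ->.
apply: IH => [||l hl]; first by rewrite ltn_half_double.
  by rewrite ltn_half_double.
by rewrite -!bitS hb.
Qed.

Definition bits (n : nat) (i : 'I_(2 ^ n)) : {ffun 'I_n -> bool} :=
  [ffun l : 'I_n => bit i l].

Lemma bits_inj (n : nat) : injective (@bits n).
Proof.
move=> i j /ffunP hij; apply: ord_inj.
apply: (bit_inj (ltn_ord i) (ltn_ord j)) => l hl.
by have := hij (Ordinal hl); rewrite !ffunE.
Qed.

Lemma bits_bij (n : nat) : bijective (@bits n).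
Proof.
apply: inj_card_bij (@bits_inj n) _.
by rewrite card_ffun card_bool !card_ord.
Qed.

(** Indices correspond bijectively to bit strings, so this is distributivity. It reduces products
    and traces of Pauli operators to a single qubit. *)
Lemma sum_prod_bit (R : comNzRingType) (n : nat) (G : 'I_n -> bool -> R) :
  \sum_(i < 2 ^ n) \prod_(l < n) G l (bit i l)
  = \prod_(l < n) \sum_(b : bool) G l b.
Proof.
rewrite bigA_distr_bigA (reindex (@bits n)) /=; last exact/onW_bij/bits_bij.
by apply: eq_bigr => i _; apply: eq_bigr => l _; rewrite ffunE.
Qed.

Lemma prod_bit_eq (R : comNzRingType) (n : nat) (i j : 'I_(2 ^ n)) :
  \prod_(l < n) (bit i l == bit j l)%:R = (i == j)%:R :> R.
Proof.
case: eqVneq => [->|hij]; first by rewrite big1 // => l _; rewrite eqxx.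
have /existsP[l hl] : [exists l : 'I_n, bit i l != bit j l].
  apply: contraNT hij => /existsPn h; apply/eqP/bits_inj/ffunP => l.
  by rewrite !ffunE; apply/eqP; have := h l; rewrite negbK.
by rewrite (bigD1 l) //= (negbTE hl) mul0r.
Qed.

End BinaryDigits.

(** * Pauli labels as an elementary abelian 2-group *)

Section PauliLabels.

(** A label is read as two bits, added bitwise. Since 1 and 2 give 3, this is the product of Pauli
    matrices up to phase. *)
Definition xor4 (a b : 'I_4) : 'I_4 :=
  inord (odd a (+) odd b + 2 * (odd a./2 (+) odd b./2)).

Lemma ord4_ind (P : 'I_4 -> Prop) :
  P (inord 0) -> P (inord 1) -> P (inord 2) -> P (inord 3) -> forall a, P a.
Proof.
move=> h0 h1 h2 h3 a; rewrite -(inord_val a).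
by case: a => -[|[|[|[|m]]]].
Qed.

Ltac ord4 :=
  rewrite /xor4 /=; repeat (rewrite inordK //=); try done.

Lemma xor4C : commutative xor4.
Proof. by move=> a b; rewrite /xor4 addbC [_ (+) odd b./2]addbC. Qed.

Lemma xor4A : associative xor4.
Proof.
by elim/ord4_ind; elim/ord4_ind; elim/ord4_ind; apply: val_inj; ord4.
Qed.

Lemma xor40 a : xor4 a ord0 = a.
Proof. by elim/ord4_ind: a; apply: val_inj; ord4. Qed.

Lemma xor4aa a : xor4 a a = ord0.
Proof. by elim/ord4_ind: a; apply: val_inj; ord4. Qed.

Variable n : nat.
Local Notation K := {ffun 'I_n -> 'I_4}.

Definition kx (a b : K) : K := [ffun l => xor4 (a l) (b l)].
Definition k0 : K := [ffun=> ord0].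

Lemma kxC : commutative kx.
Proof. by move=> a b; apply/ffunP => l; rewrite !ffunE xor4C. Qed.

Lemma kxA : associative kx.
Proof. by move=> a b c; apply/ffunP => l; rewrite !ffunE xor4A. Qed.

Lemma kx0 a : kx a k0 = a.
Proof. by apply/ffunP => l; rewrite !ffunE xor40. Qed.

Lemma k0x a : kx k0 a = a.
Proof. by rewrite kxC kx0. Qed.

Lemma kxx a : kx a a = k0.
Proof. by apply/ffunP => l; rewrite !ffunE xor4aa. Qed.

Lemma kxK a b : kx (kx a b) b = a.
Proof. by rewrite -kxA kxx kx0. Qed.

Lemma kKx a b : kx a (kx a b) = b.
Proof. by rewrite kxA kxx k0x. Qed.

Lemma kx_eq0 a b : (kx a b == k0) = (a == b).
Proof.
apply/eqP/eqP => [h|->]; last exact: kxx.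
by rewrite -[a](kxK a b) h k0x.
Qed.

Lemma kx_bij c : bijective (kx^~ c).
Proof. by exists (kx^~ c) => a; exact: kxK. Qed.

End PauliLabels.
Arguments k0 {n}.

(** * Products, commutation signs, traces and completeness of the Pauli operators *)

Section PauliOperators.
Variable C : numClosedFieldType.

Definition chi1 (a b : 'I_4) : C :=
  if [|| a == ord0, b == ord0 | a == b] then 1 else -1.

(* sigma_a sigma_b = phi1 a b sigma_(xor4 a b), from XY = iZ and its cyclic shifts *)
Definition phi1 (a b : 'I_4) : C :=
  if [|| a == ord0, b == ord0 | a == b] then 1
  else if b == (a.+1 %% 3 + 3 * (a == 2 :> nat))%N :> nat then 'i else - 'i.

Ltac ord4s := rewrite /phi1 /chi1 /sigma /xor4 -?val_eqE /=;
  repeat (rewrite inordK //=).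

Lemma sigma_mul a b r c :
  \sum_(x : bool) sigma C a r x * sigma C b x c = phi1 a b * sigma C (xor4 a b) r c.
Proof.
have ii : 'i * 'i = -1 :> C by rewrite -expr2 sqrCi.
rewrite big_bool /=.
by elim/ord4_ind: a; elim/ord4_ind: b; case: r; case: c; ord4s; ring: ii.
Qed.

Lemma sigma_conj a r c : (sigma C a r c)^* = sigma C a c r.
Proof.
elim/ord4_ind: a; case: r; case: c; ord4s; rewrite ?conjC0 ?conjC1 ?rmorphN /= ?conjCi ?opprK ?conjC1 //.
Qed.

Lemma sigma_tr a : \sum_(x : bool) sigma C a x x = 2 * (a == ord0)%:R.
Proof. by rewrite big_bool /=; elim/ord4_ind: a; ord4s; ring. Qed.

Lemma sigma_complete r c r' c' :
  \sum_(a : 'I_4) sigma C a r c * sigma C a r' c' = 2 * (r == c')%:R * (c == r')%:R.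
Proof.
have ii : 'i * 'i = -1 :> C by rewrite -expr2 sqrCi.
rewrite !big_ord_recl big_ord0 /sigma /=.
by case: r; case: c; case: r'; case: c' => /=; ring: ii.
Qed.

Lemma sum_chi1 b : \sum_(a : 'I_4) chi1 a b = 4 * (b == ord0)%:R.
Proof.
rewrite !big_ord_recl big_ord0 /=; elim/ord4_ind: b; ord4s; ring.
Qed.

Lemma phi1_sq a b : phi1 a b ^+ 2 = chi1 a b.
Proof. by rewrite /phi1 /chi1; do 2?case: ifP => _; rewrite ?sqrrN ?sqrCi ?expr1n. Qed.

Lemma chi1C a b : chi1 a b = chi1 b a.
Proof. by rewrite /chi1 orbCA (eq_sym a b) [(b == a)]eq_sym (eq_sym b). Qed.

Lemma chi1_kx a b c : chi1 a (xor4 b c) = chi1 a b * chi1 a c.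
Proof.
by elim/ord4_ind: a; elim/ord4_ind: b; elim/ord4_ind: c; ord4s;
   rewrite ?mul1r ?mulr1 ?mulrNN ?mulr1.
Qed.

Lemma phi1C a b : phi1 a b = chi1 a b * phi1 b a.
Proof.
by elim/ord4_ind: a; elim/ord4_ind: b; ord4s; rewrite ?mul1r ?mulN1r ?opprK.
Qed.

Lemma chi1_sq a b : chi1 a b ^+ 2 = 1.
Proof. by rewrite /chi1; case: ifP => _; rewrite ?sqrrN expr1n. Qed.

Variable n : nat.
Local Notation K := {ffun 'I_n -> 'I_4}.
Local Notation d := ((2 ^ n)%:R : C).
Local Notation W := (@pauli C n).

Definition chi (a b : K) : C := \prod_(l < n) chi1 (a l) (b l).
Definition phi (a b : K) : C := \prod_(l < n) phi1 (a l) (b l).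

Lemma chiC a b : chi a b = chi b a.
Proof. by apply: eq_bigr => l _; rewrite chi1C. Qed.

Lemma chi_kxr a b c : chi a (kx b c) = chi a b * chi a c.
Proof. by rewrite -big_split; apply: eq_bigr => l _; rewrite ffunE chi1_kx. Qed.

Lemma chi_kxl a b c : chi (kx a b) c = chi a c * chi b c.
Proof. by rewrite chiC chi_kxr !(chiC c). Qed.

Lemma chi_sq a b : chi a b ^+ 2 = 1.
Proof. by rewrite -prodrXl big1 // => l _; rewrite chi1_sq. Qed.

Lemma chi_mulss a b : chi a b * chi a b = 1.
Proof. by rewrite -expr2 chi_sq. Qed.

Lemma chiP a b : chi a b = 1 \/ chi a b = -1.
Proof.
have /eqP := chi_sq a b; rewrite sqrf_eq1 => /orP[] /eqP ->; by [left|right].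
Qed.

Lemma chi_conj a b : (chi a b)^* = chi a b.
Proof. by case: (chiP a b) => ->; rewrite ?rmorphN rmorph1. Qed.

Lemma chi0r a : chi a k0 = 1.
Proof. by rewrite -(kxx a) chi_kxr chi_mulss. Qed.

Lemma chi0l a : chi k0 a = 1.
Proof. by rewrite chiC chi0r. Qed.

Lemma chixx a : chi a a = 1.
Proof. by rewrite /chi big1 // => l _; rewrite /chi1 eqxx !orbT. Qed.

(** The phase is real when the two operators commute and imaginary when they anticommute. Phases
    that occur in pairs thus reduce to signs. *)
Lemma phi_sq a b : phi a b ^+ 2 = chi a b.
Proof. by rewrite -prodrXl; apply: eq_bigr => l _; rewrite phi1_sq. Qed.

(** Orthogonality of characters, computed factor by factor; it contains the nondegeneracy of the
    commutation pairing. *)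
Lemma sum_chi b : \sum_(a : K) chi a b = d ^+ 2 * (b == k0)%:R.
Proof.
rewrite /chi -(bigA_distr_bigA (fun l x => chi1 x (b l))).
rewrite (eq_bigr (fun l => 4 * (b l == ord0)%:R)); last by move=> l _; exact: sum_chi1.
rewrite big_split /= prodr_const card_ord.
have -> : 4%:R ^+ n = d ^+ 2 :> C by rewrite -!natrX -expnM mulnC expnM.
congr (_ * _); case: eqVneq => [->|hb].
  by rewrite big1 // => l _; rewrite ffunE eqxx.
have /existsP[l hl] : [exists l, b l != ord0].
  apply: contraNT hb => /existsPn h; apply/eqP/ffunP => l.
  by rewrite ffunE; apply/eqP; have := h l; rewrite negbK.
by rewrite (bigD1 l) //= (negbTE hl) mul0r.
Qed.

Lemma pauli_mul a b : W a *m W b = phi a b *: W (kx a b).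
Proof.
apply/matrixP => i j; rewrite !mxE.
rewrite (eq_bigr (fun x : 'I_(2 ^ n) => \prod_(l < n)
   (sigma C (a l) (bit i l) (bit x l) * sigma C (b l) (bit x l) (bit j l)))); last first.
  by move=> x _; rewrite !mxE big_split.
rewrite (sum_prod_bit (fun l x => sigma C (a l) (bit i l) x * sigma C (b l) x (bit j l))).
rewrite -big_split; apply: eq_bigr => l _ /=.
by rewrite sigma_mul ffunE.
Qed.

Lemma pauli_comm a b : W a *m W b = chi a b *: (W b *m W a).
Proof.
rewrite !pauli_mul scalerA kxC; congr (_ *: _).
by rewrite -big_split; apply: eq_bigr => l _ /=; exact: phi1C.
Qed.

Lemma adj_pauli a : adj (W a) = W a.
Proof.
apply/matrixP => i j; rewrite !mxE rmorph_prod.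
by apply: eq_bigr => l _; exact: sigma_conj.
Qed.

Lemma pauli0 : W k0 = 1%:M.
Proof.
apply/matrixP => i j; rewrite !mxE -prod_bit_eq.
by apply: eq_bigr => l _; rewrite ffunE /sigma /=; case: eqP.
Qed.

Lemma pauli_sq a : W a *m W a = 1%:M.
Proof.
rewrite pauli_mul kxx pauli0 /phi big1 ?scale1r // => l _.
by rewrite /phi1 eqxx !orbT.
Qed.

Lemma tr_pauli a : \tr (W a) = d * (a == k0)%:R.
Proof.
rewrite /mxtrace; rewrite (eq_bigr (fun x : 'I_(2 ^ n) => \prod_(l < n)
   sigma C (a l) (bit x l) (bit x l))); last by move=> x _; rewrite !mxE.
rewrite (sum_prod_bit (fun l x => sigma C (a l) x x)).
rewrite (eq_bigr (fun l => 2 * (a l == ord0)%:R)); last by move=> l _; exact: sigma_tr.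
rewrite big_split /= prodr_const card_ord -natrX; congr (_ * _).
case: eqVneq => [->|hb].
  by rewrite big1 // => l _; rewrite ffunE eqxx.
have /existsP[l hl] : [exists l, a l != ord0].
  apply: contraNT hb => /existsPn h; apply/eqP/ffunP => l.
  by rewrite ffunE; apply/eqP; have := h l; rewrite negbK.
by rewrite (bigD1 l) //= (negbTE hl) mul0r.
Qed.

(** In entries: the sum of all [W k] tensored with themselves is [d] times the swap operator. *)
Lemma pauli_complete i j i' j' :
  \sum_(k : K) W k i j * W k i' j' = d * (i == j')%:R * (j == i')%:R.
Proof.
rewrite (eq_bigr (fun k : K => \prod_(l < n)
   (sigma C (k l) (bit i l) (bit j l) * sigma C (k l) (bit i' l) (bit j' l)))); last first.
  by move=> k _; rewrite !mxE big_split.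
rewrite -(bigA_distr_bigA (fun (l : 'I_n) x => sigma C x (bit i l) (bit j l) * sigma C x (bit i' l) (bit j' l))).
rewrite (eq_bigr (fun l : 'I_n => 2 * (bit i l == bit j' l)%:R * (bit j l == bit i' l)%:R)); last first.
  by move=> l _; exact: sigma_complete.
by rewrite !big_split /= prodr_const card_ord -natrX !prod_bit_eq.
Qed.

Lemma pauli_expand (A : 'M[C]_(2 ^ n)) :
  \sum_(k : K) \tr (W k *m A) *: W k = d *: A.
Proof.
apply/matrixP => i j; rewrite summxE.
under eq_bigr => k _.
  rewrite mxE /mxtrace mulr_suml.
  under eq_bigr => x _ do rewrite mxE mulr_suml.
  over.
rewrite exchange_big /=.
under eq_bigr => x _ do rewrite exchange_big /=.
under eq_bigr => x _ do under eq_bigr => y _ do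
  (under eq_bigr => k _ do rewrite mulrAC; rewrite -mulr_suml pauli_complete).
rewrite (bigD1 j) //= [X in _ + X]big1 ?addr0 => [|x hx]; last first.
  by rewrite big1 // => y _; rewrite (negbTE hx) mulr0 !mul0r.
rewrite (bigD1 i) //= [X in _ + X]big1 ?addr0 => [|x hx]; last first.
  by rewrite (negbTE hx) mulr0 !mul0r.
by rewrite !eqxx !mulr1 mxE.
Qed.

Lemma d_gt0 : 0 < d.
Proof. by rewrite ltr0n expn_gt0. Qed.

Lemma d_neq0 : d != 0.
Proof. exact: lt0r_neq0 d_gt0. Qed.

End PauliOperators.

(** * Transitivity of transvections on labels, and the Fourier transform given by [chi] *)

Section SymplecticTransitivity.
Variables (C : numClosedFieldType) (n : nat).
Local Notation K := {ffun 'I_n -> 'I_4}.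
Local Notation d := ((2 ^ n)%:R : C).
Local Notation chi := (@chi C n).

(* h does not lie in the F_2-span of L *)
Fixpoint outspan (L : seq K) (h : K) : bool :=
  if L is u :: L' then outspan L' h && outspan L' (kx h u) else h != k0.

(** Expanding the product gives the characters at [h] plus the subset sums of [L]. None of these
    labels is [k0], so each character sums to zero; [outspan] recurses along the same expansion. *)
Lemma sum_chi_prod L h : outspan L h ->
  \sum_(e : K) chi e h * \prod_(u <- L) (1 + chi e u) = 0.
Proof.
elim: L h => [|u L IH] h /=.
  move=> hh; under eq_bigr => e _ do rewrite big_nil mulr1.
  by rewrite sum_chi (negbTE hh) mulr0.
case/andP=> h1 h2.
under eq_bigr => e _ do rewrite big_cons mulrDl mul1r mulrDr mulrA -chi_kxr.
by rewrite big_split /= IH // IH // addr0.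
Qed.

(** The product in [sum_chi_prod] vanishes unless [e] commutes with all of [L]. If all such [e]
    commuted with [h] as well, a vanishing sum would consist of nonnegative terms with a positive
    one at [k0]. *)
Lemma exists_perp L h : outspan L h ->
  exists2 e, (forall u, u \in L -> chi e u = 1) & chi e h = -1.
Proof.
move=> hL.
have [/existsP[e /andP[/allP h1 /eqP h2]]|/existsPn hn] :=
    boolP [exists e, all (fun u => chi e u == 1) L && (chi e h == -1)].
  by exists e => // u /h1/eqP.
have ge0 e : 0 <= chi e h * \prod_(u <- L) (1 + chi e u).
  have [hall|/allPn[u uL hu]] := boolP (all (fun u => chi e u == 1) L).
    have := hn e; rewrite hall /=; case: (chiP C e h) => ->; last by rewrite eqxx.
    move=> _; rewrite mul1r; apply: prodr_ge0 => u _.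
    by case: (chiP C e u) => ->; rewrite ?subrr // addr_ge0.
  rewrite (big_rem u) //=; case: (chiP C e u) hu => ->; rewrite ?eqxx //.
  by rewrite subrr mul0r mulr0.
have /eqP := sum_chi_prod hL; rewrite psumr_eq0 // => /allP /(_ k0).
rewrite mem_index_enum => /(_ isT) /=; rewrite chi0l mul1r => /eqP h0.
have : 0 < \prod_(u <- L) (1 + chi k0 u).
  by apply: prodr_gt0 => u _; rewrite chi0l addr_gt0.
by rewrite h0 ltxx.
Qed.

(* Two transvections, by e and e + h + h', carry h to h' while fixing L pointwise. *)
Lemma transvection_transitive (T : Type) (L : seq K) (F : K -> T) h h' :
  (forall w, (forall u, u \in L -> chi w u = 1) ->
     forall x, chi w x = -1 -> F (kx w x) = F x) ->
  outspan L h -> outspan L h' -> (forall u, u \in L -> chi u h = chi u h') ->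
  F h = F h'.
Proof.
move=> hF oh oh' hu; pose w := kx h h'.
have wu u : u \in L -> chi w u = 1.
  by move=> uL; rewrite chi_kxl chiC hu // (chiC _ u) chi_mulss.
have wh : chi w h = chi h h' by rewrite chi_kxl chixx mul1r chiC.
have wxh : kx w h = h' by rewrite /w kxC kKx.
(* If [h] and [h'] anticommute, the single transvection by [w] already carries one to the other. *)
case: (chiP C h h') => hh'; last by rewrite -wxh hF // wh.
have /exists_perp[e eL eh] : outspan (w :: L) h by rewrite /= oh /w kKx.
have eu u : u \in L -> chi e u = 1 by move=> uL; apply: eL; rewrite inE uL orbT.
have ew : chi e w = 1 by apply: eL; rewrite inE eqxx.
rewrite -(hF e) // -wxh -(hF (kx e w)).
- by congr F; rewrite -kxA (kxC w) -kxA kKx kxC.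
- by move=> u uL; rewrite chi_kxl eu // wu // mulr1.
- by rewrite chi_kxl !chi_kxr chixx eh (chiC _ w e) ew wh hh'; ring.
Qed.

(** Outside [Z], [D] is constant on each of the two classes of the sign [chi g]. Adding the
    fixed-point equations at [k0] and at [g], the latter with sign [chi g h], gives weight 2 to the
    class of [h] and 0 to the other one. *)
Lemma fourier_fixed_eq0 (D : K -> C) g (Z : pred K) :
  (forall a, d * D a = \sum_(h : K) chi a h * D h) ->
  D k0 = 0 -> D g = 0 -> (forall h, Z h -> D h = 0) ->
  (forall h h', ~~ Z h -> ~~ Z h' -> chi g h = chi g h' -> D h = D h') ->
  forall h, D h = 0.
Proof.
move=> hF h0 hg hZ hc h; have [/hZ//|nZ] := boolP (Z h).
have eq0 : \sum_(x : K) (1 + chi g h * chi g x) * D x = 0.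
  transitivity (d * D k0 + chi g h * (d * D g)); last by rewrite h0 hg !mulr0 addr0.
  rewrite !hF mulr_sumr -big_split /=; apply: eq_bigr => x _.
  by rewrite chi0l; ring.
pose B := [pred x : K | ~~ Z x & chi g h == chi g x].
have : \sum_(x : K | B x) 2 * D h = 0.
  rewrite -[RHS]eq0 big_mkcond /=; apply: eq_bigr => x _.
  have [zx|nzx] := boolP (Z x); first by rewrite (hZ _ zx) mulr0.
  rewrite /=; case: eqP => [e|ne]; first by rewrite -e chi_mulss (hc h x).
  suff -> : chi g h * chi g x = -1 by rewrite subrr mul0r.
  by move: ne; case: (chiP C g h) => ->; case: (chiP C g x) => -> //; rewrite ?mul1r ?mulr1.
rewrite sumr_const => /eqP; rewrite mulrn_eq0 mulf_eq0 (pnatr_eq0 _ 2) /=.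
case/orP=> [/eqP/card0_eq/(_ h)|/eqP//].
by rewrite unfold_in /= nZ eqxx.
Qed.

Lemma sum_chi_chi a b : \sum_(h : K) chi a h * chi h b = d ^+ 2 * (a == b)%:R.
Proof.
rewrite -kx_eq0 -sum_chi; apply: eq_bigr => h _.
by rewrite chi_kxr (chiC _ a).
Qed.

(** The real symmetric matrix [chi] squares to [d ^+ 2], so its eigenvalues are [d] and [-d].
    Concretely, the sum of [|d y - Y|^2] equals [2 d] times the gap of the inequality. *)
Lemma fourier_form_le (y : K -> C) :
  \sum_(g : K) (y g)^* * (\sum_(h : K) chi g h * y h) <= d * \sum_(g : K) `|y g| ^+ 2.
Proof.
pose Y g := \sum_(h : K) chi g h * y h.
have Yc g : (Y g)^* = \sum_(h : K) chi g h * (y h)^*.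
  by rewrite rmorph_sum; apply: eq_bigr => h _; rewrite rmorphM /= chi_conj.
have swap (u v : K -> C) : \sum_(g : K) u g * (\sum_(h : K) chi g h * v h)
    = \sum_(g : K) v g * (\sum_(h : K) chi g h * u h).
  under eq_bigr => g _ do rewrite mulr_sumr.
  rewrite exchange_big /=; apply: eq_bigr => h _.
  by rewrite mulr_sumr; apply: eq_bigr => g _; rewrite (chiC _ h); ring.
have FF (u : K -> C) g : \sum_(h : K) chi g h * (\sum_(x : K) chi h x * u x) = d ^+ 2 * u g.
  under eq_bigr => h _ do rewrite mulr_sumr.
  rewrite exchange_big /=.
  under eq_bigr => x _ do (under eq_bigr => h _ do rewrite mulrA; rewrite -mulr_suml sum_chi_chi).
  rewrite (bigD1 g) //= eqxx mulr1 big1 ?addr0 // => x /negbTE.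
  by rewrite eq_sym => ->; rewrite mulr0 mul0r.
set q := (X in X <= _); set N := \sum_(g : K) _.
have : 0 <= \sum_(g : K) `|d * y g - Y g| ^+ 2.
  by apply: sumr_ge0 => g _; rewrite exprn_ge0.
have YY : d ^+ 2 * N = \sum_(g : K) Y g * (Y g)^*.
  under [RHS]eq_bigr => g _ do rewrite Yc.
  rewrite swap; under [RHS]eq_bigr => g _ do rewrite FF.
  by rewrite mulr_sumr; apply: eq_bigr => g _; rewrite normCK; ring.
have qE : q = \sum_(g : K) y g * (Y g)^*.
  by under [RHS]eq_bigr => g _ do rewrite Yc; rewrite swap.
have -> : \sum_(g : K) `|d * y g - Y g| ^+ 2 = d *+ 2 * (d * N - q).
  transitivity (d ^+ 2 * N - d * q - d * (\sum_(g : K) y g * (Y g)^*)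
                + \sum_(g : K) Y g * (Y g)^*); last by rewrite -qE -YY; ring.
  rewrite /N /q !mulr_sumr -!sumrB -big_split /=; apply: eq_bigr => g _.
  by rewrite !normCK rmorphB rmorphM /= conjC_nat; rewrite -/(Y g); ring.
by rewrite pmulr_rge0 ?subr_ge0 // mulrn_wgt0 // d_gt0.
Qed.

End SymplecticTransitivity.

(** * Rules for the adjoint *)

Section Adjoint.
Variable C : numClosedFieldType.

Lemma adj_mxM m k l (A : 'M[C]_(m, k)) (B : 'M[C]_(k, l)) : adj (A *m B) = adj B *m adj A.
Proof. by rewrite /adj map_mxM trmx_mul. Qed.

Lemma adj_mxK m k (A : 'M[C]_(m, k)) : adj (adj A) = A.
Proof. by apply/matrixP => i j; rewrite !mxE conjCK. Qed.

Lemma adj_mxZ m k a (A : 'M[C]_(m, k)) : adj (a *: A) = a^* *: adj A.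
Proof. by apply/matrixP => i j; rewrite !mxE rmorphM. Qed.

Lemma adj_mxD m k (A B : 'M[C]_(m, k)) : adj (A + B) = adj A + adj B.
Proof. by apply/matrixP => i j; rewrite !mxE rmorphD. Qed.

Lemma adj_mx1 m : adj (1%:M : 'M[C]_m) = 1%:M.
Proof. by apply/matrixP => i j; rewrite !mxE rmorph_nat eq_sym. Qed.

Lemma tr_adj m (A : 'M[C]_m) : \tr (adj A) = (\tr A)^*.
Proof. by rewrite /mxtrace rmorph_sum; apply: eq_bigr => i _; rewrite !mxE. Qed.

End Adjoint.

(** * Paulis and transvections as Clifford unitaries *)

Section CliffordGroup.
Variables (C : numClosedFieldType) (n : nat).
Local Notation K := {ffun 'I_n -> 'I_4}.
Local Notation d := ((2 ^ n)%:R : C).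
Local Notation chi := (@chi C n).
Local Notation W := (@pauli C n).

Lemma unit4P (c : C) : (c = 1 \/ c = -1 \/ c = 'i \/ c = - 'i) <-> c ^+ 4 = 1.
Proof.
have i4 : 'i ^+ 4 = 1 :> C by rewrite (exprM _ 2 2) sqrCi sqrrN expr1n.
split=> [[->|[->|[->|->]]]|/eqP]; rewrite ?(exprM (- _) 2 2) ?sqrrN -?exprM ?expr1n ?i4 //.
rewrite (exprM _ 2 2) sqrf_eq1 -{1}sqrCi eqf_sqr sqrf_eq1.
case/orP=> /orP[] /eqP ->; [by left|by right; left|by right; right; left|by right; right; right].
Qed.

Lemma in_pauli_groupP (P : 'M[C]_(2 ^ n)) :
  in_pauli_group P <-> exists c k, c ^+ 4 = 1 /\ P = c *: W k.
Proof.
by split=> -[c [k [h1 h2]]]; exists c, k; split=> //; apply/unit4P.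
Qed.

Lemma clifford_mul (U V : 'M[C]_(2 ^ n)) : clifford U -> clifford V -> clifford (U *m V).
Proof.
move=> [[U1 U2] U3] [[V1 V2] V3]; split; first split.
- by rewrite adj_mxM mulmxA -(mulmxA U) V1 mulmx1 U1.
- by rewrite adj_mxM mulmxA -(mulmxA _ (adj U)) U2 mulmx1 V2.
- move=> P /V3/U3; by rewrite adj_mxM !mulmxA.
Qed.

Lemma clifford1 : clifford (1%:M : 'M[C]_(2 ^ n)).
Proof.
by split; [split|]; rewrite ?adj_mx1 ?mulmx1 // => P; rewrite mul1mx mulmx1.
Qed.

Lemma clifford_of_pauli_images (U : 'M[C]_(2 ^ n)) : unitary U ->
  (forall k, exists c k', c ^+ 4 = 1 /\ U *m W k *m adj U = c *: W k') -> clifford U.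
Proof.
move=> hU h; split=> // P /in_pauli_groupP[c [k [c4 ->]]].
have [c' [k' [c'4 e]]] := h k; apply/in_pauli_groupP; exists (c * c'), k'.
by rewrite exprMn c4 c'4 mul1r -scalemxAr -scalemxAl e scalerA.
Qed.

Lemma pauli_conj a b : W a *m W b *m W a = chi a b *: W b.
Proof. by rewrite pauli_comm -scalemxAl -mulmxA pauli_sq mulmx1. Qed.

Lemma pauli_clifford a : clifford (W a).
Proof.
apply: clifford_of_pauli_images; first by split; rewrite adj_pauli pauli_sq.
move=> k; exists (chi a k), k; rewrite adj_pauli pauli_conj.
by rewrite (exprM _ 2 2) chi_sq expr1n.
Qed.

(* exp(pi/4 e W_w) for e = +-'i *)
Definition rot (e : C) (w : K) : 'M[C]_(2 ^ n) := (sqrtC 2)^-1 *: (1%:M + e *: W w).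

Definition transv := rot 'i.

Lemma adj_transv w : adj (transv w) = rot (- 'i) w.
Proof.
rewrite /transv /rot adj_mxZ adj_mxD adj_mx1 adj_mxZ adj_pauli conjCi; congr (_ *: _).
by rewrite fmorphV /= conj_Creal // ger0_real // sqrtC_ge0 ler0n.
Qed.

Lemma rot_mul e e' w :
  rot e w *m rot e' w = 2^-1 *: ((1 + e * e')%:M + (e + e') *: W w).
Proof.
rewrite /rot -scalemxAr -scalemxAl scalerA -invfM -expr2 sqrtCK; congr (_ *: _).
rewrite mulmxDl mul1mx mulmxDr mulmx1 -scalemxAl -scalemxAr pauli_sq scalerA.
by rewrite scalemx1 raddfD scalerDl /= [_ + (e * e')%:M]addrC addrACA [e' *: _ + _]addrC.
Qed.

Lemma rot_inv e w : e ^+ 2 = -1 -> rot e w *m rot (- e) w = 1%:M.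
Proof.
move=> he; rewrite rot_mul mulrN -expr2 he opprK subrr scale0r addr0.
by rewrite -scalemx1 scalerA mulVf ?scale1r // pnatr_eq0.
Qed.

(** Moving [W h] past [rot e w] flips the sign of [e] exactly when [w] and [h] anticommute. What
    remains is [rot (- e) w] times its inverse, or its square, which is [- e *: W w]. *)
Lemma rot_conj e w h : e ^+ 2 = -1 ->
  rot (- e) w *m W h *m rot e w = if chi w h == 1 then W h else - e *: (W w *m W h).
Proof.
move=> he; rewrite -mulmxA.
have -> : W h *m rot e w = rot (chi w h * e) w *m W h.
  rewrite /rot -scalemxAl -scalemxAr; congr (_ *: _).
  rewrite mulmxDl mulmxDr mul1mx mulmx1 -scalemxAl -scalemxAr.
  by rewrite [W h *m _]pauli_comm scalerA (chiC _ h) mulrC.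
rewrite mulmxA; case: (chiP C w h) => ->.
  by rewrite eqxx mul1r -{2}[e]opprK rot_inv ?mul1mx // sqrrN.
rewrite mulN1r ifF; last by rewrite eqNr oner_eq0.
rewrite rot_mul mulrNN -expr2 he subrr raddf0 add0r -mulr2n scalerA -[X in _ * X]mulr_natl.
by rewrite mulKf ?pnatr_eq0 // -scalemxAl.
Qed.

Lemma transv_unitary w : unitary (transv w).
Proof.
split; rewrite adj_transv ?rot_inv ?sqrCi //.
by rewrite /transv -{2}['i]opprK rot_inv // sqrrN sqrCi.
Qed.

Lemma transv_conj w h : adj (transv w) *m W h *m transv w =
  if chi w h == 1 then W h else - 'i *: (W w *m W h).
Proof. by rewrite adj_transv rot_conj // sqrCi. Qed.

Lemma chi_neq1 (a b : K) : chi a b != 1 -> chi a b = -1.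
Proof. by case: (chiP C a b) => -> //; rewrite eqxx. Qed.

Lemma phi4 (a b : K) : phi C a b ^+ 4 = 1.
Proof. by rewrite (exprM _ 2 2) phi_sq chi_sq. Qed.

Lemma transv_clifford w : clifford (transv w).
Proof.
apply: clifford_of_pauli_images (transv_unitary w) _ => k.
have -> : transv w *m W k *m adj (transv w)
    = if chi w k == 1 then W k else 'i *: (W w *m W k).
  by have := @rot_conj (- 'i) w k; rewrite sqrrN sqrCi opprK -adj_transv => ->.
case: eqP => [_|/eqP /chi_neq1 e].
  by exists 1, k; rewrite expr1n scale1r.
exists ('i * phi C w k), (kx w k); rewrite exprMn phi4 mulr1 pauli_mul scalerA.
by split=> //; apply/unit4P; do 2 right; left.
Qed.

End CliffordGroup.

(** * The functions f_c,g and their symmetries *)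

Section PauliPairs.
Variables (C : numClosedFieldType) (n : nat).
Local Notation K := {ffun 'I_n -> 'I_4}.
Local Notation d := ((2 ^ n)%:R : C).
Local Notation chi := (@chi C n).
Local Notation W := (@pauli C n).

Definition pairf (c g : K) (A : 'M[C]_(2 ^ n)) : C :=
  \tr (W g *m A) * \tr (W g *m W c *m A).

(** A rank-one orthogonal projector described without a vector; the third clause is the form in
    which rank one enters. *)
Definition pure (P : 'M[C]_(2 ^ n)) : Prop :=
  [/\ adj P = P, \tr P = 1 & forall A, P *m A *m P = \tr (A *m P) *: P].

Lemma tr_pauli_mul g c (A : 'M[C]_(2 ^ n)) :
  \tr (W g *m W c *m A) = phi C g c * \tr (W (kx g c) *m A).
Proof. by rewrite pauli_mul -scalemxAl mxtraceZ. Qed.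

(** Both traces on the right carry the phase [phi C g c], and the sign is its square, so a fourth
    power of the phase remains, which is 1. *)
Lemma tr_kx_pair g c (A B : 'M[C]_(2 ^ n)) :
  \tr (W (kx g c) *m A) * \tr (W (kx g c) *m B)
  = chi g c * (\tr (W g *m W c *m A) * \tr (W g *m W c *m B)).
Proof.
rewrite !tr_pauli_mul -phi_sq.
have := phi4 C g c; move: (phi C g c) => p p4.
transitivity (p ^+ 4 * (\tr (W (kx g c) *m A) * \tr (W (kx g c) *m B))); last by ring.
by rewrite p4 mul1r.
Qed.

Lemma pairf_kx c g A : pairf c (kx g c) A = chi g c * pairf c g A.
Proof.
have -> : pairf c (kx g c) A = \tr (W (kx g c) *m A) * \tr (W (kx g c) *m (W c *m A)).
  by rewrite /pairf mulmxA.
rewrite tr_kx_pair; congr (_ * _); rewrite mulrC; congr (_ * _).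
by rewrite !mulmxA -(mulmxA (W g)) pauli_sq mulmx1.
Qed.

Lemma tr_pauli_conj g (A : 'M[C]_(2 ^ n)) : adj A = A ->
  (\tr (W g *m A))^* = \tr (W g *m A).
Proof. by move=> hA; rewrite -tr_adj adj_mxM hA adj_pauli mxtrace_mulC. Qed.

Lemma pairf_conj c g A : adj A = A -> (pairf c g A)^* = chi g c * pairf c g A.
Proof.
move=> hA; rewrite /pairf rmorphM /= tr_pauli_conj // mulrCA; congr (_ * _).
rewrite -tr_adj !adj_mxM hA !adj_pauli mxtrace_mulC pauli_comm chiC.
by rewrite -scalemxAl mxtraceZ.
Qed.

(** Rank one merges the two traces into the single trace of [W g P W g] against [W c P]. Expanding
    [P] in the Pauli basis then turns conjugation by [W g] into the signs [chi g h]. *)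
Lemma pairf_fierz c g P : pure P -> d * pairf c g P = \sum_(h : K) chi g h * pairf c h P.
Proof.
case=> _ _ hP.
have -> : pairf c g P = \tr ((W g *m P *m W g) *m (W c *m P)).
  have -> : (W g *m P *m W g) *m (W c *m P) = W g *m (P *m (W g *m W c) *m P).
    by rewrite !mulmxA.
  by rewrite hP -scalemxAr mxtraceZ mulrC.
rewrite -mxtraceZ scalemxAl.
have -> : d *: (W g *m P *m W g) = \sum_(h : K) (chi g h * \tr (W h *m P)) *: W h.
  rewrite scalemxAl scalemxAr -pauli_expand mulmx_sumr mulmx_suml.
  by apply: eq_bigr => h _; rewrite -scalemxAr -scalemxAl pauli_conj scalerA mulrC.
rewrite mulmx_suml raddf_sum; apply: eq_bigr => h _ /=.
by rewrite -scalemxAl mxtraceZ mulmxA mulrA.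
Qed.

Lemma tr_expand (A B : 'M[C]_(2 ^ n)) :
  d * \tr (A *m B) = \sum_(g : K) \tr (W g *m A) * \tr (W g *m B).
Proof.
rewrite -mxtraceZ scalemxAl -pauli_expand mulmx_suml raddf_sum.
by apply: eq_bigr => h _ /=; rewrite -scalemxAl mxtraceZ.
Qed.

(** Squaring [tr_expand] gives a double sum over two labels; the second is written as the first plus
    [c]. *)
Lemma sqr_tr_expand (A B : 'M[C]_(2 ^ n)) :
  d ^+ 2 * \tr (A *m B) ^+ 2
  = \sum_(c : K) \sum_(g : K) chi g c * pairf c g B * pairf c g A.
Proof.
rewrite -exprMn tr_expand expr2 mulr_suml exchange_big /=; apply: eq_bigr => g _.
rewrite mulr_sumr (reindex (kx g)) /=; last by exists (kx g) => x _; exact: kKx.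
apply: eq_bigr => c _; rewrite tr_kx_pair /pairf; ring.
Qed.

(** The sign depends on [c] and not on [g]: Pauli conjugation acts on each family f_c by a
    character, distinct for distinct [c]. *)
Lemma pairf_pauli k c g P : pairf c g (W k *m P *m adj (W k)) = chi k c * pairf c g P.
Proof.
rewrite /pairf adj_pauli.
have e A : \tr (A *m (W k *m P *m W k)) = \tr (W k *m A *m W k *m P).
  by rewrite mulmxA mxtrace_mulC !mulmxA.
rewrite !e pauli_conj.
have -> : W k *m (W g *m W c) *m W k = (chi k g * chi k c) *: (W g *m W c).
  rewrite -scalerA scalemxAr -pauli_conj scalemxAl -pauli_conj.
  by rewrite !mulmxA -[_ *m W k *m W k]mulmxA pauli_sq mulmx1.
rewrite -!scalemxAl !mxtraceZ mulrACA; congr (_ * _).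
by rewrite mulrA chi_mulss mul1r.
Qed.

(** As [w] commutes with [c], conjugation fixes [W c]. When [w] and [h] anticommute, both factors
    acquire [- 'i] and [phi C w h]; these square to -1 each, so no sign is left. *)
Lemma pairf_transv w c h P : chi w c = 1 ->
  pairf c h (transv C w *m P *m adj (transv C w))
  = pairf c (if chi w h == 1 then h else kx w h) P.
Proof.
move=> wc; rewrite /pairf.
have e A : \tr (A *m (transv C w *m P *m adj (transv C w)))
           = \tr (adj (transv C w) *m A *m transv C w *m P).
  by rewrite mulmxA mxtrace_mulC !mulmxA.
have [u1 u2] := transv_unitary C w.
rewrite !e.
have -> : adj (transv C w) *m (W h *m W c) *m transv C w
   = (adj (transv C w) *m W h *m transv C w) *m (adj (transv C w) *m W c *m transv C w).
  by rewrite !mulmxA -[_ *m transv C w *m adj _]mulmxA u1 mulmx1.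
rewrite !transv_conj wc eqxx; case: eqP => // /eqP /chi_neq1 wh.
rewrite -!scalemxAl !mxtraceZ mulrACA mulrNN -expr2 sqrCi.
rewrite pauli_mul -!scalemxAl !mxtraceZ mulrACA -expr2 phi_sq wh.
by rewrite mulrA mulrNN mul1r mul1r.
Qed.

End PauliPairs.

(** * The map induced by a Clifford unitary on Pauli labels *)

Section CliffordAction.
Variables (C : numClosedFieldType) (n : nat).
Local Notation K := {ffun 'I_n -> 'I_4}.
Local Notation W := (@pauli C n).

Lemma clifford_images (U : 'M[C]_(2 ^ n)) : clifford U ->
  exists (pi : K -> K) (cc : K -> C),
    forall k, cc k ^+ 4 = 1 /\ U *m W k *m adj U = cc k *: W (pi k).
Proof.
case=> _ hU.
have h k : exists ck : C * K, ck.1 ^+ 4 = 1 /\ U *m W k *m adj U = ck.1 *: W ck.2.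
  have /in_pauli_groupP[c [k' h]] : in_pauli_group (U *m W k *m adj U).
    by apply/hU/in_pauli_groupP; exists 1, k; rewrite expr1n scale1r.
  by exists (c, k').
have [F hF] := fin_all_exists h.
by exists (fun k => (F k).2), (fun k => (F k).1).
Qed.

(** Two labels with the same image would give proportional Paulis, whereas distinct Paulis are
    orthogonal for the trace and [W a] squares to the identity. *)
Lemma clifford_images_inj (U : 'M[C]_(2 ^ n)) (pi : K -> K) (cc : K -> C) : unitary U ->
  (forall k, cc k ^+ 4 = 1 /\ U *m W k *m adj U = cc k *: W (pi k)) -> injective pi.
Proof.
move=> [U1 U2] hpi a b hab.
have inv A : adj U *m (U *m A *m adj U) *m U = A.
  by rewrite !mulmxA U2 mul1mx -mulmxA U2 mulmx1.
have [[ca ea] [cb eb]] := (hpi a, hpi b).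
have cb0 : cc b != 0 by apply: contra_eq_neq cb => ->; rewrite expr0n /= eq_sym oner_eq0.
have e : W a = (cc a / cc b) *: W b.
  rewrite -(inv (W a)) ea hab -[in RHS](inv (W b)) eb -!scalemxAr -!scalemxAl scalerA.
  by rewrite divfK.
have : \tr (W a *m W a) != 0 by rewrite pauli_sq mxtrace1 d_neq0.
rewrite {2}e -scalemxAr pauli_mul !mxtraceZ tr_pauli kx_eq0.
by case: (eqVneq a b) => // _; rewrite !mulr0 eqxx.
Qed.

End CliffordAction.

(** * Averages over the Clifford orbit *)

Section OrbitAverage.
Variables (C : numClosedFieldType) (n : nat).
Local Notation K := {ffun 'I_n -> 'I_4}.
Local Notation d := ((2 ^ n)%:R : C).
Local Notation W := (@pauli C n).
Variables (z : 'cV[C]_(2 ^ n)) (s : seq 'M[C]_(2 ^ n)).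
Hypothesis hz : adj z *m z = 1%:M.
Hypothesis hs : clifford_orbit_enum z s.

Definition avg (F : 'M[C]_(2 ^ n) -> C) : C := (size s)%:R^-1 * \sum_(P <- s) F P.

Lemma proj_pure : pure (proj z).
Proof.
split; first by rewrite /proj adj_mxM adj_mxK.
  by rewrite /proj mxtrace_mulC hz mxtrace1.
move=> A; rewrite /proj !mulmxA -(mulmxA _ (adj z) A) -(mulmxA z).
rewrite [adj z *m A *m z]mx11_scalar mul_mx_scalar -scalemxAl.
by rewrite mxtrace_mulC !mulmxA /mxtrace big_ord1.
Qed.

Lemma pure_conj (U P : 'M[C]_(2 ^ n)) : unitary U -> pure P -> pure (U *m P *m adj U).
Proof.
move=> [U1 U2] [h1 h2 h3]; split; first by rewrite !adj_mxM adj_mxK h1 mulmxA.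
  by rewrite mxtrace_mulC mulmxA U2 mul1mx.
move=> A.
have -> : U *m P *m adj U *m A *m (U *m P *m adj U)
   = U *m (P *m (adj U *m A *m U) *m P) *m adj U by rewrite !mulmxA.
rewrite h3 -scalemxAr -scalemxAl; congr (_ *: _).
by rewrite [RHS]mxtrace_mulC -!mulmxA [RHS]mxtrace_mulC !mulmxA -!mulmxA mxtrace_mulC !mulmxA.
Qed.

Lemma orbit_pure P : P \in s -> pure P.
Proof. by case/(hs.2 P)=> U [[hU _] ->]; apply: pure_conj hU proj_pure. Qed.

Lemma orbit_nonempty : (0 < size s)%N.
Proof.
have : proj z \in s.
  by apply/(hs.2 _); exists 1%:M; rewrite adj_mx1 mul1mx mulmx1; split=> //; exact: clifford1.
by case: (s).
Qed.

Lemma size_neq0 : (size s)%:R != 0 :> C.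
Proof. by rewrite pnatr_eq0 -lt0n orbit_nonempty. Qed.

(** Conjugation by [V] maps the orbit injectively into itself, hence permutes a duplicate-free
    enumeration of it. *)
Lemma orbit_perm (V : 'M[C]_(2 ^ n)) : clifford V ->
  perm_eq [seq V *m P *m adj V | P <- s] s.
Proof.
move=> hV; have [V1 V2] := hV.1.
have inj : injective (fun P => V *m P *m adj V).
  move=> P Q /(congr1 (fun A => adj V *m A *m V)).
  by rewrite !mulmxA V2 !mul1mx -!mulmxA V2 !mulmx1.
have un : uniq [seq V *m P *m adj V | P <- s] by rewrite map_inj_uniq // hs.1.
have sub : {subset [seq V *m P *m adj V | P <- s] <= s}.
  move=> _ /mapP[P /(hs.2 P)[U [hU ->]] ->]; apply/(hs.2 _).
  by exists (V *m U); rewrite adj_mxM !mulmxA; split=> //; exact: clifford_mul.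
apply: uniq_perm => //; first exact: hs.1.
by have [] := uniq_min_size un sub; rewrite ?size_map.
Qed.

Lemma avg_conj F V : clifford V -> avg (fun P => F (V *m P *m adj V)) = avg F.
Proof.
move=> hV; rewrite /avg; congr (_ * _).
by rewrite -[RHS](perm_big _ (orbit_perm hV)) /= big_map.
Qed.

Lemma avg_ext F G : (forall P, F P = G P) -> avg F = avg G.
Proof. by move=> h; rewrite /avg; congr (_ * _); apply: eq_bigr. Qed.

Lemma avg_eq F G : (forall P, pure P -> F P = G P) -> avg F = avg G.
Proof.
move=> h; rewrite /avg; congr (_ * _); rewrite big_seq [RHS]big_seq.
by apply: eq_bigr => P /orbit_pure /h.
Qed.

Lemma avg_const a : avg (fun=> a) = a.
Proof. by rewrite /avg big_const_seq iter_addr_0 count_predT -[a *+ _]mulr_natl mulKf ?size_neq0. Qed.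

Lemma avg_sum (I : finType) (F : I -> 'M[C]_(2 ^ n) -> C) :
  avg (fun P => \sum_i F i P) = \sum_i avg (F i).
Proof. by rewrite /avg exchange_big mulr_sumr. Qed.

Lemma avgZ a F : avg (fun P => a * F P) = a * avg F.
Proof. by rewrite /avg -mulr_sumr mulrCA. Qed.

Lemma avgD F G : avg (fun P => F P + G P) = avg F + avg G.
Proof. by rewrite /avg big_split mulrDr. Qed.

Lemma avg_ge0 F : (forall P, pure P -> 0 <= F P) -> 0 <= avg F.
Proof.
move=> h; rewrite /avg mulr_ge0 ?invr_ge0 ?ler0n // big_seq.
by apply: sumr_ge0 => P /orbit_pure /h.
Qed.

(* Conjugation by a Clifford unitary permutes the Paulis up to fourth roots of unity. *)
Lemma orbit_fourth_moment P : P \in s ->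
  \sum_(k : K) \tr (W k *m P) ^+ 4 = d ^+ 2 * alpha z.
Proof.
case/(hs.2 P) => U [[[U1 U2] hU] ->].
have [pi [cc hpi]] : exists (pi : K -> K) (cc : K -> C),
    forall k, cc k ^+ 4 = 1 /\ U *m W k *m adj U = cc k *: W (pi k).
  exact: clifford_images.
rewrite /alpha mulrA divff ?mul1r; last by rewrite expf_neq0 // d_neq0.
rewrite (reindex_inj (clifford_images_inj (conj U1 U2) hpi)) /=.
apply: eq_bigr => k _; have [c4 e] := hpi k.
have -> : (adj z *m W k *m z) 0 0 = \tr (W k *m proj z).
  by rewrite /proj mulmxA mxtrace_mulC mulmxA /mxtrace big_ord1.
have -> : \tr (W k *m proj z) = \tr (cc k *: W (pi k) *m (U *m proj z *m adj U)).
  rewrite -e -!mulmxA [RHS]mxtrace_mulC !mulmxA -(mulmxA _ (adj U) U) U2 mulmx1.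
  by rewrite -(mulmxA _ (adj U) U) U2 mulmx1.
by rewrite -scalemxAl mxtraceZ exprMn c4 mul1r.
Qed.

End OrbitAverage.

(** * Model rows fixed by the Fourier transform *)

Section FourierFixedRows.
Variables (C : numClosedFieldType) (n : nat).
Local Notation K := {ffun 'I_n -> 'I_4}.
Local Notation d := ((2 ^ n)%:R : C).
Local Notation chi := (@chi C n).

(* (1 + F/d) applied to delta_g + chi(g,c) delta_(g+c), where F = (chi a h)_(a,h) *)
Definition rfun (c g h : K) : C :=
  (h == g)%:R + chi g c * (h == kx g c)%:R + d^-1 * chi g h * (1 + chi g c * chi c h).

Lemma sum_delta (F : K -> C) g : \sum_(h : K) F h * (h == g)%:R = F g.
Proof.
by rewrite (bigD1 g) //= eqxx mulr1 big1 ?addr0 // => h /negbTE->; rewrite mulr0.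
Qed.

(** Since F squares to [d ^+ 2], the image of 1 + F/d lies in the eigenspace of F for [d]. *)
Lemma rfun_fierz c g a : d * rfun c g a = \sum_(h : K) chi a h * rfun c g h.
Proof.
have d0 := d_neq0 C n.
transitivity (\sum_(h : K) (chi a h * (h == g)%:R + chi g c * (chi a h * (h == kx g c)%:R)
   + (d^-1 * (chi a h * chi h g) + d^-1 * chi g c * (chi a h * chi h (kx g c))))); last first.
  by apply: eq_bigr => h _; rewrite /rfun chi_kxr !(chiC _ h); ring.
rewrite !big_split /= -!mulr_sumr !sum_delta !sum_chi_chi chi_kxr.
by rewrite /rfun (chiC _ c a) (chiC _ g a); field.
Qed.

Lemma kx_swap (g h c : K) : (h == kx g c) = (g == kx h c).
Proof. by apply/eqP/eqP => ->; rewrite kxK. Qed.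

Lemma kx_eqr (g h c : K) : (kx g c == kx h c) = (g == h).
Proof. by apply/eqP/eqP => [e|->//]; rewrite -(kxK g c) e kxK. Qed.

Lemma rfunC c g h : rfun c g h = rfun c h g.
Proof.
rewrite /rfun (eq_sym g h) (kx_swap g) (chiC _ g h) !(chiC _ c); congr (_ + _ + _); last by ring.
by case: eqP => [->|_]; rewrite ?mulr0 // chi_kxl chixx !mulr1.
Qed.

Lemma rfun_kx c g h : rfun c g (kx h c) = chi h c * rfun c g h.
Proof.
have hh := chi_mulss C h c; have gg := chi_mulss C g c.
have ->: rfun c g (kx h c) = (chi g c * (h == kx g c)%:R) * chi g c
   + (h == g)%:R * chi g c + d^-1 * chi g h * (chi g c + chi h c).
  rewrite /rfun chi_kxr chi_kxr chixx (chiC _ c h) kx_eqr (eq_sym _ g) -(kx_swap g h).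
  ring: gg.
rewrite /rfun (chiC _ c h) !mulrDr; congr (_ + _).
  rewrite addrC; congr (_ + _); first by case: eqP => [->|]; rewrite ?mul1r ?mul0r ?mulr1 ?mulr0.
  by case: eqP => [->|]; rewrite ?mulr0 ?mul0r // chi_kxl chixx; ring.
ring: hh.
Qed.

Lemma rfun_mix c g h : chi c h != chi c g -> rfun c g h = 0.
Proof.
move=> ne; rewrite /rfun.
have -> : (h == g) = false by apply: contraNF ne => /eqP->.
have -> : (h == kx g c) = false.
  by apply: contraNF ne => /eqP->; rewrite chi_kxr chixx mulr1.
rewrite (chiC _ g c); move: ne; case: (chiP C c g) => ->; case: (chiP C c h) => ->;
  rewrite ?eqxx //= => _; ring.
Qed.

Lemma rfun_off c g h : h != g -> h != kx g c ->
  rfun c g h = d^-1 * chi g h * (1 + chi g c * chi c h).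
Proof. by rewrite /rfun => /negbTE-> /negbTE->; rewrite mulr0 !add0r. Qed.

Lemma rfun_diag c g : c != k0 -> rfun c g g = 1 + 2 / d.
Proof.
move=> c0; rewrite /rfun eqxx chixx (chiC _ c) chi_mulss.
have -> : (g == kx g c) = false.
  by apply: contraNF c0; rewrite eq_sym -kx_eq0 (kxC g) kxK.
by rewrite mulr0 addr0 mulr1 mulrC.
Qed.

End FourierFixedRows.

(** * Symmetries of the covariance and the rigidity of its rows *)

Section Covariance.
Variables (C : numClosedFieldType) (n : nat).
Local Notation K := {ffun 'I_n -> 'I_4}.
Local Notation d := ((2 ^ n)%:R : C).
Local Notation chi := (@chi C n).
Local Notation W := (@pauli C n).
Local Notation rfun := (@rfun C n).
Variables (z : 'cV[C]_(2 ^ n)) (s : seq 'M[C]_(2 ^ n)).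
Hypothesis hz : adj z *m z = 1%:M.
Hypothesis hs : clifford_orbit_enum z s.
Local Notation avg := (avg s).

Definition cov (c g h : K) : C := avg (fun P => pairf c g P * (pairf c h P)^*).

(** Some [W k] has opposite commutation signs with [c] and [c']; conjugating the orbit by it negates
    the average. *)
Lemma cov_cross c c' g h : c != c' ->
  avg (fun P => pairf c g P * (pairf c' h P)^*) = 0.
Proof.
move=> ne; have /exists_perp-/(_ C)[k _] : outspan [::] (kx c c') by rewrite /= kx_eq0.
rewrite chi_kxr => hk.
set F := fun P => _; have : avg F = - avg F; last first.
  by move/eqP; rewrite -addr_eq0 -mulr2n mulrn_eq0 /= => /eqP.
rewrite -{1}(avg_conj hs F (pauli_clifford C k)) -mulN1r -avgZ; apply: avg_ext => P; rewrite /F !pairf_pauli rmorphM /= chi_conj -hk; ring.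
Qed.

Lemma avg_pairf_eq0 c g : c != k0 -> avg (pairf c g) = 0.
Proof.
move=> ne; rewrite -(@cov_cross c k0 g k0 ne); apply: (avg_eq hz hs) => P [_ t _].
by rewrite /pairf !pauli0 !mul1mx t mulr1 rmorph1 mulr1.
Qed.

Lemma cov_fierz c g a : d * cov c g a = \sum_(h : K) chi a h * cov c g h.
Proof.
rewrite /cov -avgZ.
rewrite (eq_bigr (fun h => avg (fun P => chi a h * (pairf c g P * (pairf c h P)^*)))); last first.
  by move=> h _; rewrite avgZ.
rewrite -avg_sum; apply: (avg_eq hz hs) => P pP.
transitivity (pairf c g P * (d * pairf c a P)^*).
  by rewrite [(d * _)^*]rmorphM /= conjC_nat; ring.
rewrite (pairf_fierz _ _ pP) rmorph_sum mulr_sumr; apply: eq_bigr => h _.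
by rewrite /= [(chi _ _ * _)^*]rmorphM /= chi_conj; ring.
Qed.

Lemma cov_kx c g h : cov c g (kx h c) = chi h c * cov c g h.
Proof.
rewrite /cov -avgZ; apply: avg_ext => P.
by rewrite pairf_kx [(chi _ _ * _)^*]rmorphM /= chi_conj; ring.
Qed.

Lemma cov_transv c g w h : chi w c = 1 -> chi w g = 1 -> chi w h = -1 ->
  cov c g (kx w h) = cov c g h.
Proof.
move=> wc wg wh; rewrite /cov -[RHS](avg_conj hs _ (transv_clifford C w)).
apply: avg_ext => P.
by rewrite !pairf_transv // wg wh eqxx ifF // eqNr oner_eq0.
Qed.

(** The transvection by [c] itself multiplies f_c,x by [chi c x], because it moves [x] by [c] when
    the two anticommute. Labels with different signs are therefore uncorrelated. *)
Lemma cov_mix c g h : chi c h != chi c g -> cov c g h = 0.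
Proof.
move=> ne; have hk : chi c g * chi c h = -1.
  by move: ne; case: (chiP C c g) => ->; case: (chiP C c h) => ->; rewrite ?eqxx // => _; ring.
have : cov c g h = - cov c g h; last first.
  by move/eqP; rewrite -addr_eq0 -mulr2n mulrn_eq0 /= => /eqP.
rewrite {1}/cov -(avg_conj hs _ (transv_clifford C c)) -mulN1r -avgZ.
apply: avg_ext => P.
have tau x : pairf c x (transv C c *m P *m adj (transv C c)) = chi c x * pairf c x P.
  rewrite pairf_transv ?chixx //; case: eqP => [->|_]; first by rewrite mul1r.
  by rewrite kxC pairf_kx chiC.
by rewrite !tau rmorphM /= chi_conj -hk; ring.
Qed.

(** Rigidity: once [l] and [mu] make the model agree with a row at [k0] and at [g], they make it
    agree everywhere. The covariance and the model share the translation rule, the Fourier equation,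
    the vanishing of mixed entries and the constancy on classes. *)
Lemma cov_row c g l mu :
  let D h := cov c g h - (l * rfun c g h + mu * rfun c k0 g * rfun c k0 h) in
  D k0 = 0 -> D g = 0 -> forall h, D h = 0.
Proof.
move=> D D0 Dg.
(* [Z] holds the labels where [D] is seen to vanish directly: the span of [c] and [g], reached from
   [k0] and [g] by translation by [c], and the mixed labels. *)
pose Z h := ~~ outspan [:: c; g] h || (chi c h != chi c g).
have Dkx h : D (kx h c) = chi h c * D h.
  by rewrite /D cov_kx !rfun_kx; ring.
apply: (@fourier_fixed_eq0 C n D g Z) => //.
- move=> a; rewrite /D mulrBr cov_fierz mulrDr.
  rewrite (_ : d * (l * rfun c g a) = l * (d * rfun c g a)); last by ring.
  rewrite (_ : d * (mu * rfun c k0 g * rfun c k0 a)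
             = mu * rfun c k0 g * (d * rfun c k0 a)); last by ring.
  rewrite !rfun_fierz !mulr_sumr -big_split -sumrB /=.
  by apply: eq_bigr => h _; ring.
- move=> h /orP[|ne].
    rewrite /= !negb_and !negbK => /orP[] /orP[] /eqP e.
    + by rewrite e.
    + by move/eqP: e; rewrite kx_eq0 => /eqP->.
    + by move/eqP: e; rewrite kx_eq0 => /eqP->; rewrite -(k0x c) Dkx D0 mulr0.
    + move/eqP: e; rewrite kx_eq0 => /eqP e.
      by rewrite -(kxK h c) e Dkx Dg mulr0.
  rewrite /D cov_mix // rfun_mix // mulr0 !add0r.
  have [hg|hg] := eqVneq (chi c g) 1; last by rewrite [rfun c k0 g]rfun_mix ?chi0r // mulr0 mul0r oppr0.
  by rewrite [rfun c k0 h]rfun_mix ?mulr0 ?oppr0 // chi0r -hg.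
- move=> h h'; rewrite !negb_or !negbK => /andP[oh /eqP ch] /andP[oh' /eqP ch'] gh.
  have nin x : outspan [:: c; g] x -> [/\ x != k0, x != kx k0 c, x != g & x != kx g c].
    rewrite /= => /andP[/andP[x0 xg] /andP[xc xcg]].
    rewrite k0x x0 -!(kx_eq0 x) xc xg; split=> //.
    by rewrite (kxC g) kxA.
  have [h0 hc hg hgc] := nin _ oh; have [h0' hc' hg' hgc'] := nin _ oh'.
  rewrite /D (rfun_off C hg hgc) (rfun_off C hg' hgc') (rfun_off C h0 hc) (rfun_off C h0' hc') ch ch' gh !chi0l; congr (_ - _).
  apply: (@transvection_transitive C n C [:: c; g] (cov c g)) => // [w hw x|u].
    by apply: cov_transv; apply: hw; rewrite !inE eqxx ?orbT.
  by rewrite !inE => /orP[] /eqP->; rewrite ?ch ?ch'.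
Qed.

End Covariance.

(** * The covariance in closed form, and the range of [theta] *)

Section CovarianceValues.
Variables (C : numClosedFieldType) (n : nat).
Local Notation K := {ffun 'I_n -> 'I_4}.
Local Notation d := ((2 ^ n)%:R : C).
Local Notation chi := (@chi C n).
Local Notation W := (@pauli C n).
Local Notation rfun := (@rfun C n).
Variables (z : 'cV[C]_(2 ^ n)) (s : seq 'M[C]_(2 ^ n)).
Hypothesis hn : (1 <= n)%N.
Hypothesis hz : adj z *m z = 1%:M.
Hypothesis hs : clifford_orbit_enum z s.
Local Notation avg := (avg s).
Local Notation cov := (cov s).

(* Affine reparametrisation of alpha z: theta = 0 at the lower bound
   alpha = 2 / (d (d + 1)), theta = 1 on stabiliser states, alpha = 1 / d. *)
Definition theta : C := (d * (d + 1) * alpha z - 2) / (d - 1).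
(** The coefficients in [cov0E] and [covcE], chosen to match the entries that [cov_row] asks for.
    For [c] other than [k0], [lam1] serves the rows commuting with [c] and [lam2] the anticommuting
    ones; [mu0] and [mu1] weight the rank-one parts. *)
Definition lam0 : C := theta * d / (2 * (d + 1) * (d + 2)).
Definition mu0 : C := d ^+ 2 * (d + 2 - theta) / (4 * (d + 2) * (d + 1) ^+ 2).
Definition lam1 : C := d * (d + theta * (d + 2)) / ((d + 4) * (d + 2) * (d + 1) ^+ 2).
Definition lam2 : C := (1 - theta) * d / ((d + 2) * (d + 1) ^+ 2).
Definition mu1 : C := d ^+ 2 * (d + 2 - theta) / ((d + 4) * (d + 2) * (d + 1) ^+ 2).

Lemma d_ge2 : 2 <= d.
Proof. by rewrite ler_nat -[X in (X <= _)%N](expn1 2) leq_exp2l. Qed.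

Lemma dD_neq0 k : d + k%:R != 0.
Proof. by rewrite lt0r_neq0 // ltr_wpDr ?ler0n // d_gt0. Qed.

Lemma d1_neq0 : d - 1 != 0.
Proof. by rewrite subr_eq0 gt_eqF // (lt_le_trans _ d_ge2) // ltr1n. Qed.

Lemma pairf0 g (P : 'M[C]_(2 ^ n)) : pairf k0 g P = \tr (W g *m P) ^+ 2.
Proof. by rewrite /pairf pauli0 mulmx1. Qed.

Lemma pairf00 c (P : 'M[C]_(2 ^ n)) : pure P -> pairf c k0 P = \tr (W c *m P).
Proof. by case=> _ t _; rewrite /pairf pauli0 !mul1mx t mul1r. Qed.

Lemma cov000 : cov k0 k0 k0 = 1.
Proof.
rewrite -[RHS](avg_const hs); apply: (avg_eq hz hs) => P pP.
by rewrite pairf00 // pauli0 mul1mx; case: pP => _ -> _; rewrite rmorph1 mulr1.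
Qed.

Lemma cov_diag_sum : \sum_(g : K) cov k0 g g = d ^+ 2 * alpha z.
Proof.
rewrite -avg_sum -[RHS](avg_const hs) /avg; congr (_ * _).
rewrite big_seq [RHS]big_seq; apply: eq_bigr => P Ps.
rewrite -(orbit_fourth_moment hs Ps); apply: eq_bigr => g _.
have [hP _ _] := orbit_pure hz hs Ps.
by rewrite pairf0 rmorphXn /= tr_pauli_conj // -exprD.
Qed.

(** Transvections are transitive on nonzero labels, so these [d ^+ 2 - 1] diagonal entries coincide;
    their sum is known from [alpha z] once the entry 1 at [k0] is removed. *)
Lemma cov_diag0 g : g != k0 -> cov k0 g g = (1 + theta * d) / (d + 1) ^+ 2.
Proof.
move=> g0.
have cst h : h != k0 -> cov k0 h h = cov k0 g g.
  move=> h0; apply: (@transvection_transitive C n C [::] (fun x => cov k0 x x)) => // w _ x wx.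
  rewrite /cov -[RHS](avg_conj hs _ (transv_clifford C w)); apply: avg_ext => P.
  by rewrite !pairf_transv ?chi0r // wx ifF // eqNr oner_eq0.
have := cov_diag_sum; rewrite (bigD1 k0) //= cov000.
rewrite (eq_bigr (fun=> cov k0 g g)); last by move=> h /cst.
rewrite sumr_const (_ : #|_| = ((2 ^ n) ^ 2).-1)%N; last first.
  have -> : ((2 ^ n) ^ 2 = #|{: K}|)%N.
    by rewrite card_ffun !card_ord -expnM mulnC expnM.
  by rewrite -(cardC1 (k0 : K)); apply: eq_card.
have e : (((2 ^ n) ^ 2).-1)%:R = d ^+ 2 - 1 :> C.
  by rewrite -natrX -[in RHS](@prednK ((2 ^ n) ^ 2)) ?expn_gt0 // -natr1 addrK.
rewrite -[_ *+ _]mulr_natl e /theta.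
have := d1_neq0; have /= := dD_neq0 1; move: (cov k0 g g) (alpha z) => A a.
move: d => D h1 h2 h.
have -> : A = (D ^+ 2 * a - 1) / (D ^+ 2 - 1).
  have D0 : D ^+ 2 - 1 != 0 by rewrite subr_sqr_1 mulf_neq0.
  by rewrite -h (addrC 1) addrK mulrAC divff ?mul1r.
have D0 : D ^+ 2 - 1 != 0 by rewrite subr_sqr_1 mulf_neq0.
by field; rewrite h1 h2 D0.
Qed.

Lemma rfun0_diag g : rfun k0 g g = 2 + 2 / d.
Proof. rewrite /rfun !(eqxx, kx0) chi0r chixx chi0l mulr1n; by field; exact: d_neq0. Qed.

Lemma rfun0_off g h : h != g -> rfun k0 g h = 2 / d * chi g h.
Proof.
by move=> hg; rewrite rfun_off ?kx0 // chi0r chi0l; field; exact: d_neq0.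
Qed.

Lemma cov_sym c g : chi c g = 1 -> cov c g k0 = cov c k0 g.
Proof.
move=> cg; apply: (avg_eq hz hs) => P [hP _ _].
by rewrite !pairf_conj // chi0l (chiC _ g) cg !mul1r mulrC.
Qed.

(** In row [g], the entry at [k0] comes from row [k0] by symmetry and the diagonal entry from
    [cov_diag0]. *)
Lemma cov0E g h : cov k0 g h = lam0 * rfun k0 g h + mu0 * rfun k0 k0 g * rfun k0 k0 h.
Proof.
(* For [g = k0] the two conditions of [cov_row] coincide, so only one entry has to be checked. *)
have row0 x : cov k0 k0 x - (lam0 * rfun k0 k0 x + mu0 * rfun k0 k0 k0 * rfun k0 k0 x) = 0.
  have D0 : cov k0 k0 k0 - (lam0 * rfun k0 k0 k0 + mu0 * rfun k0 k0 k0 * rfun k0 k0 k0) = 0.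
    rewrite cov000 rfun0_diag /lam0 /mu0; move: theta => t.
    have := d_neq0 C n; have := dD_neq0 1; have := dD_neq0 2; move: d => D /= h1 h2 h3.
    by field; rewrite h1 h2 h3.
  exact: (cov_row hz hs).
apply/eqP; rewrite -subr_eq0; apply/eqP; apply: (cov_row hz hs).
  by rewrite cov_sym ?chi0l // -[RHS](row0 g) (rfunC _ k0 g); ring.
have [->|g0] := eqVneq g k0; first exact: row0.
rewrite cov_diag0 // rfun0_diag rfun0_off // chi0l /lam0 /mu0; move: theta => t.
have := d_neq0 C n; have := dD_neq0 1; have := dD_neq0 2; move: d => D /= h1 h2 h3.
by field; rewrite h1 h2 h3.
Qed.

Lemma cov_c00 c : cov c k0 k0 = cov k0 k0 c.
Proof.
apply: (avg_eq hz hs) => P pP; have [hP t _] := pP.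
by rewrite !pairf00 // pairf0 pauli0 mul1mx t mul1r rmorphXn /= !tr_pauli_conj.
Qed.

(** The squared modulus of f_c,g is a product of two squared traces, hence a product of two
    functions f_k0. This carries the values found for [k0] over to every [c]. *)
Lemma cov_cgg c g : cov c g g = cov k0 g (kx g c).
Proof.
apply: (avg_eq hz hs) => P [hP _ _].
rewrite pairf_conj // pairf_conj // chi0r !pairf0 mul1r.
by rewrite (expr2 (\tr (W (kx g c) *m P))) tr_kx_pair /pairf; ring.
Qed.

Definition lamc (c g : K) : C := if chi c g == 1 then lam1 else lam2.

Lemma covcE c g h : c != k0 ->
  cov c g h = lamc c g * rfun c g h + mu1 * rfun c k0 g * rfun c k0 h.
Proof.
move=> c0.
have fld := (dD_neq0 4, dD_neq0 2, dD_neq0 1, d_neq0 C n).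
have row0 x : cov c k0 x - (lam1 * rfun c k0 x + mu1 * rfun c k0 k0 * rfun c k0 x) = 0.
  have D0 : cov c k0 k0 - (lam1 * rfun c k0 k0 + mu1 * rfun c k0 k0 * rfun c k0 k0) = 0.
    rewrite cov_c00 cov0E rfun0_diag rfun0_off // chi0l rfun_diag // /lam0 /lam1 /mu0 /mu1.
    move: theta => t; move: fld; move: d => D /= fld.
    by field; rewrite !fld.
  exact: (cov_row hz hs).
apply/eqP; rewrite -subr_eq0; apply/eqP; apply: (cov_row hz hs).
  have [cg|] := eqVneq (chi c g) 1.
    by rewrite cov_sym // /lamc cg eqxx -[RHS](row0 g) (rfunC _ c g); ring.
  move=> cg; rewrite (cov_mix hs) ?chi0r 1?eq_sym // [rfun c k0 g]rfun_mix ?chi0r //.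
  by rewrite [rfun c g k0]rfun_mix ?chi0r 1?eq_sym //; ring.
have [->|g0] := eqVneq g k0; first by rewrite /lamc chi0r eqxx; exact: row0.
(* For [g = c], translation by [c] carries both indices to [k0], where the row is settled; the
   off-diagonal formulas below require [g] to differ from [c]. *)
have [->|gc] := eqVneq g c.
  rewrite /lamc chixx eqxx.
  have e x : rfun c x c = rfun c x k0 by rewrite -{2}(k0x c) rfun_kx chi0l mul1r.
  have ec : cov c c c = cov c c k0 by rewrite -{3}(k0x c) cov_kx chi0l mul1r.
  rewrite !e ec cov_sym ?chixx // (rfunC _ c c) e -{2}(k0x c) cov_kx chi0l mul1r.
  exact: row0.
have gcg : kx g c != g by apply: contraNneq c0 => e; rewrite -(kKx g c) e kxx.
have gc0 : kx g c != k0 by rewrite kx_eq0.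
rewrite cov_cgg cov0E !rfun0_off // rfun_diag // !chi0l chi_kxr chixx mul1r.
rewrite [rfun c k0 g]rfun_off ?k0x // !chi0l !mul1r /lamc (chiC _ g c) /lam0 /lam1 /lam2 /mu0 /mu1.
move: fld; move: theta => t; move: d => D /= fld.
case: (chiP C c g) => ->; rewrite ?eqxx ?(eqNr, oner_eq0) /=; field; by rewrite !fld.
Qed.

Lemma exists_nonzero : exists g : K, g != k0.
Proof.
exists [ffun=> inord 1]; apply/eqP => /ffunP /(_ (Ordinal hn)).
by rewrite !ffunE => /(congr1 val); rewrite /= inordK.
Qed.

(** The second moment of a 2-design: [theta] cancels between the two terms of [cov0E]. *)
Lemma avg_sq g : g != k0 -> avg (fun P => \tr (W g *m P) ^+ 2) = (d + 1)^-1.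
Proof.
move=> g0; transitivity (cov k0 k0 g).
  rewrite -cov_c00; apply: (avg_eq hz hs) => P pP; have [hP _ _] := pP.
  by rewrite pairf00 // tr_pauli_conj.
rewrite cov0E rfun0_diag rfun0_off // chi0l /lam0 /mu0.
have fld := (dD_neq0 4, dD_neq0 2, dD_neq0 1, d_neq0 C n).
move: fld; move: theta => t; move: d => D /= fld.
by field; rewrite !fld.
Qed.

Lemma tr_pauli_real g P : pure P -> \tr (W g *m P) \is Num.real.
Proof. by case=> hP _ _; rewrite CrealE tr_pauli_conj. Qed.

(** The variance of [\tr (W g *m P) ^+ 2] over the orbit is [theta] times a positive factor. *)
Lemma theta_ge0 : 0 <= theta.
Proof.
have [g g0] := exists_nonzero.
have : 0 <= avg (fun P => (\tr (W g *m P) ^+ 2 - (d + 1)^-1) ^+ 2).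
  apply: (avg_ge0 hz hs) => P pP; apply: real_exprn_even_ge0 => //.
  rewrite rpredB // ?rpredX ?tr_pauli_real // rpredV rpredD ?rpred1 //; exact: realn.
have -> : avg (fun P => (\tr (W g *m P) ^+ 2 - (d + 1)^-1) ^+ 2)
   = cov k0 g g + (- (2 * (d + 1)^-1)) * avg (fun P => \tr (W g *m P) ^+ 2) + (d + 1)^-1 ^+ 2.
  rewrite /cov -[X in _ = _ + X](avg_const hs) -avgZ -!avgD; apply: (avg_eq hz hs) => P [hP _ _].
  by rewrite pairf_conj // chi0r mul1r pairf0; ring.
rewrite cov_diag0 // avg_sq //.
have -> : (1 + theta * d) / (d + 1) ^+ 2 + - (2 * (d + 1)^-1) * (d + 1)^-1 + (d + 1)^-1 ^+ 2
    = theta * (d / (d + 1) ^+ 2).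
  move: (dD_neq0 1) => /=; move: theta d => t D D1.
  by field.
by rewrite pmulr_lge0 // divr_gt0 ?d_gt0 // exprn_gt0 // addr_gt0 ?d_gt0.
Qed.

(** For anticommuting [g] and [h], the mean of the product of the two squared traces is [1 - theta]
    over [(d + 1) ^+ 2]. *)
Lemma theta_le1 : theta <= 1.
Proof.
have [g g0] := exists_nonzero.
have [h _ hg] := exists_perp C (L := [::]) g0.
have gh : g != h by apply: contra_eq_neq hg => ->; rewrite chixx eq_sym eqNr oner_eq0.
have h0 : h != k0 by apply: contra_eq_neq hg => ->; rewrite chi0l eq_sym eqNr oner_eq0.
have : 0 <= cov k0 h g.
  apply: (avg_ge0 hz hs) => P pP; have [hP _ _] := pP.
  rewrite pairf_conj // chi0r mul1r !pairf0.
  by rewrite mulr_ge0 // real_exprn_even_ge0 // tr_pauli_real.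
rewrite cov0E !rfun0_off // hg !chi0l /lam0 /mu0.
set x := (X in 0 <= X); have -> : x = (1 - theta) * ((d + 1) ^+ 2)^-1.
  rewrite /x; have fld := (dD_neq0 4, dD_neq0 2, dD_neq0 1, d_neq0 C n).
  move: fld; move: theta => t; move: d => D /= fld.
  by field; rewrite !fld.
rewrite pmulr_lge0 ?subr_ge0 // invr_gt0 exprn_gt0 // addr_gt0 ?d_gt0 //.
Qed.

End CovarianceValues.

(** * Upper bounds for the quadratic forms of the covariance *)

Section QuadraticForms.
Variables (C : numClosedFieldType) (n : nat).
Local Notation K := {ffun 'I_n -> 'I_4}.
Local Notation d := ((2 ^ n)%:R : C).
Local Notation chi := (@chi C n).
Local Notation W := (@pauli C n).
Local Notation rfun := (@rfun C n).
Variable c : K.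

(** On vectors obeying the translation rule, [rfun c] acts as 2 (1 + F/d). *)
Lemma rfun_apply (y : K -> C) g : (forall h, y (kx h c) = chi h c * y h) ->
  \sum_(h : K) rfun c g h * y h = 2 * y g + 2 / d * \sum_(h : K) chi g h * y h.
Proof.
move=> hy; have d0 := d_neq0 C n.
transitivity (\sum_(h : K) (y h * (h == g)%:R + chi g c * (y h * (h == kx g c)%:R)
   + (d^-1 * (chi g h * y h) + d^-1 * (chi g c * chi c h * chi g h * y h)))).
  by apply: eq_bigr => h _; rewrite /rfun; ring.
rewrite !big_split /= -!mulr_sumr !sum_delta hy mulrA chi_mulss mul1r.
have -> : \sum_(h : K) chi g c * chi c h * chi g h * y h = \sum_(h : K) chi g h * y h.
  rewrite [LHS](reindex (fun x : K => kx x c)) /=; last exact/onW_bij/kx_bij.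
  apply: eq_bigr => h _.
  rewrite hy !chi_kxr chixx (chiC _ c h).
  transitivity ((chi g c * chi g c) * (chi h c * chi h c) * (chi g h * y h)); first by ring.
  by rewrite !chi_mulss !mul1r.
by field.
Qed.

Lemma rfun_form_le (y : K -> C) : (forall h, y (kx h c) = chi h c * y h) ->
  \sum_(g : K) \sum_(h : K) (y g)^* * y h * rfun c g h <= 4 * \sum_(g : K) `|y g| ^+ 2.
Proof.
move=> hy; have d0 := d_neq0 C n; have dp := d_gt0 C n.
have -> : \sum_(g : K) \sum_(h : K) (y g)^* * y h * rfun c g h
   = 2 * (\sum_(g : K) `|y g| ^+ 2) + 2 / d * \sum_(g : K) (y g)^* * \sum_(h : K) chi g h * y h.
  rewrite !mulr_sumr -big_split /=; apply: eq_bigr => g _.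
  transitivity ((y g)^* * \sum_(h : K) rfun c g h * y h).
    by rewrite mulr_sumr; apply: eq_bigr => h _; ring.
  by rewrite rfun_apply // normCK; ring.
have -> : 4 * \sum_(g : K) `|y g| ^+ 2
   = 2 * (\sum_(g : K) `|y g| ^+ 2) + 2 / d * (d * \sum_(g : K) `|y g| ^+ 2) by field.
by rewrite lerD2l ler_wpM2l ?fourier_form_le // divr_ge0 ?ler0n.
Qed.

(** [rfun] has no entries between the two sign classes of [chi c], so [y] splits into two parts,
    each bounded with its own coefficient. *)
Lemma rfun_class_form_le (y : K -> C) (l1 l2 l : C) :
  (forall h, y (kx h c) = chi h c * y h) -> 0 <= l1 <= l -> 0 <= l2 <= l ->
  \sum_(g : K) \sum_(h : K) (y g)^* * y h * ((if chi c g == 1 then l1 else l2) * rfun c g h)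
  <= 4 * l * \sum_(g : K) `|y g| ^+ 2.
Proof.
move=> hy /andP[l10 l1l] /andP[l20 l2l].
pose yp h := if chi c h == 1 then y h else 0.
pose ym h := if chi c h == 1 then 0 else y h.
have ck h : chi c (kx h c) = chi c h by rewrite chi_kxr chixx mulr1.
have hp h : yp (kx h c) = chi h c * yp h by rewrite /yp ck hy; case: ifP; rewrite ?mulr0.
have hm h : ym (kx h c) = chi h c * ym h by rewrite /ym ck hy; case: ifP; rewrite ?mulr0.
have -> : \sum_(g : K) \sum_(h : K)
     (y g)^* * y h * ((if chi c g == 1 then l1 else l2) * rfun c g h)
  = l1 * (\sum_(g : K) \sum_(h : K) (yp g)^* * yp h * rfun c g h)
  + l2 * (\sum_(g : K) \sum_(h : K) (ym g)^* * ym h * rfun c g h).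
  rewrite !mulr_sumr -big_split; apply: eq_bigr => g _ /=.
  rewrite !mulr_sumr -big_split; apply: eq_bigr => h _ /=.
  have [e|ne] := eqVneq (chi c h) (chi c g).
    by rewrite /yp /ym e; case: ifP => _; rewrite ?conjC0; ring.
  by rewrite rfun_mix // !mulr0 addr0.
apply: (@le_trans _ _ (l1 * (4 * \sum_(g : K) `|yp g| ^+ 2) + l2 * (4 * \sum_(g : K) `|ym g| ^+ 2))).
  by rewrite lerD // ler_wpM2l // rfun_form_le.
have -> : \sum_(g : K) `|y g| ^+ 2 = \sum_(g : K) `|yp g| ^+ 2 + \sum_(g : K) `|ym g| ^+ 2.
  rewrite -big_split; apply: eq_bigr => g _ /=; rewrite /yp /ym.
  by case: ifP => _; rewrite normr0 expr0n /= ?addr0 ?add0r.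
rewrite mulrDr ![_ * (4 * _)]mulrCA !mulrA.
have ge0 (u : K -> C) : 0 <= \sum_(g : K) `|u g| ^+ 2.
  by apply: sumr_ge0 => g _; rewrite exprn_ge0.
by apply: lerD; apply: ler_wpM2r => //; apply: ler_wpM2l => //; rewrite ler0n.
Qed.

Lemma rank1_form (y r : K -> C) : (forall h, (r h)^* = r h) ->
  \sum_(g : K) \sum_(h : K) (y g)^* * y h * (r g * r h) = `|\sum_(h : K) r h * y h| ^+ 2.
Proof.
move=> hr; rewrite normCK mulrC rmorph_sum mulr_suml; apply: eq_bigr => g _.
rewrite mulr_sumr; apply: eq_bigr => h _.
by rewrite rmorphM /= hr; ring.
Qed.

Lemma rfun_conj g h : (rfun c g h)^* = rfun c g h.
Proof.
by rewrite /rfun !(rmorphD, rmorphM) /= !rmorph_nat fmorphV !chi_conj rmorph1 rmorph_nat.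
Qed.

End QuadraticForms.

(** * Second and fourth moments of tr(P X) *)

Section Moments.
Variables (C : numClosedFieldType) (n : nat).
Local Notation K := {ffun 'I_n -> 'I_4}.
Local Notation d := ((2 ^ n)%:R : C).
Local Notation chi := (@chi C n).
Local Notation W := (@pauli C n).
Local Notation rfun := (@rfun C n).
Variables (z : 'cV[C]_(2 ^ n)) (s : seq 'M[C]_(2 ^ n)).
Hypothesis hn : (1 <= n)%N.
Hypothesis hz : adj z *m z = 1%:M.
Hypothesis hs : clifford_orbit_enum z s.
Local Notation avg := (avg s).
Local Notation cov := (cov s).
Variable X : 'M[C]_(2 ^ n).
Hypothesis hX : adj X = X.
Local Notation y := (fun c g => pairf c g X).
Local Notation t1 := (\tr X).
Local Notation t2 := (\tr (X *m X)).

Definition trX_mul_X_plus_X2 : 'M[C]_(2 ^ n) := t1 *: X + X *m X.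
Local Notation Y := trX_mul_X_plus_X2.

Lemma sqr_tr_pairf P : d ^+ 2 * \tr (P *m X) ^+ 2
  = \sum_(c : K) \sum_(g : K) (y c g)^* * pairf c g P.
Proof.
rewrite sqr_tr_expand; apply: eq_bigr => c _; apply: eq_bigr => g _.
by rewrite pairf_conj.
Qed.

(** Only the family [c = k0] has nonzero means: 1 at [g = k0] and [(d + 1)^-1] elsewhere. *)
Lemma avg_sqr_tr : avg (fun P => \tr (P *m X) ^+ 2) = (t1 ^+ 2 + t2) / (d * (d + 1)).
Proof.
have d0 := d_neq0 C n; have d1 := dD_neq0 C n 1.
apply: (@mulfI _ (d ^+ 2)); first by rewrite expf_neq0.
rewrite -avgZ (avg_ext _ sqr_tr_pairf) avg_sum.
rewrite (bigD1 k0) //= [X in _ + X]big1 ?addr0 => [|c c0]; last first.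
  by rewrite avg_sum big1 // => g _; rewrite avgZ (avg_pairf_eq0 hz hs) // mulr0.
rewrite avg_sum (bigD1 k0) //= avgZ.
have -> : avg (pairf k0 k0) = 1.
  rewrite -[RHS](avg_const hs); apply: (avg_eq hz hs) => P pP.
  by rewrite pairf00 // pauli0 mul1mx; case: pP.
have yE g : (y k0 g)^* = \tr (W g *m X) ^+ 2 by rewrite pairf_conj // chi0r mul1r pairf0.
rewrite yE pauli0 mul1mx.
have -> : \sum_(g | g != k0) avg (fun P => (y k0 g)^* * pairf k0 g P)
    = (\sum_(g : K | g != k0) \tr (W g *m X) ^+ 2) / (d + 1).
  rewrite mulr_suml; apply: eq_bigr => g g0; rewrite avgZ yE; congr (_ * _).
  by rewrite -(avg_sq hn hz hs g0); apply: avg_ext => P; rewrite pairf0.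
have : \sum_(g : K) \tr (W g *m X) ^+ 2 = d * t2.
  by rewrite tr_expand; apply: eq_bigr => g _; rewrite expr2.
rewrite (bigD1 k0) //= pauli0 mul1mx => /(canRL (addKr _)) ->.
by move: d0 d1; move: d => D d0 d1; field; rewrite d0 d1.
Qed.

Lemma tr_PX_real P : pure P -> (\tr (P *m X))^* = \tr (P *m X).
Proof. by case=> hP _ _; rewrite -tr_adj adj_mxM hP hX mxtrace_mulC. Qed.

Lemma avg_fourth : d ^+ 4 * avg (fun P => \tr (P *m X) ^+ 4)
  = \sum_(c : K) \sum_(g : K) \sum_(h : K) (y c g)^* * y c h * cov c g h.
Proof.
rewrite -avgZ.
transitivity (avg (fun P => \sum_(c : K) \sum_(g : K) \sum_(c' : K) \sum_(h : K)
    (y c g)^* * y c' h * (pairf c g P * (pairf c' h P)^*))).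
  apply: (avg_eq hz hs) => P pP.
  transitivity ((d ^+ 2 * \tr (P *m X) ^+ 2) * (d ^+ 2 * \tr (P *m X) ^+ 2)^*).
    rewrite rmorphM !rmorphXn /= conjC_nat tr_PX_real //; ring.
  rewrite sqr_tr_pairf rmorph_sum mulr_suml; apply: eq_bigr => c _.
  rewrite mulr_suml; apply: eq_bigr => g _.
  rewrite mulr_sumr; apply: eq_bigr => c' _.
  rewrite /= rmorph_sum mulr_sumr; apply: eq_bigr => h _.
  by rewrite /= [((y _ _)^* * _)^*]rmorphM /= conjCK; ring.
rewrite avg_sum; apply: eq_bigr => c _; rewrite avg_sum; apply: eq_bigr => g _.
rewrite avg_sum (bigD1 c) //= [X in _ + X]big1 ?addr0 => [|c' c'c].
  by rewrite avg_sum; apply: eq_bigr => h _; rewrite avgZ.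
rewrite avg_sum big1 // => h _; rewrite avgZ (cov_cross hs) ?mulr0 //.
by rewrite eq_sym.
Qed.

Lemma y_kx c h : y c (kx h c) = chi h c * y c h.
Proof. exact: pairf_kx. Qed.

(** The rank-one part of block [c] sees [X] only through this trace. The summand [\tr X *: X] comes
    from the entry at [k0], and the square of [X] from the Fourier sum, collapsed by [tr_expand]. *)
Lemma rfun_y c : \sum_(h : K) rfun c k0 h * y c h = 2 * \tr (W c *m Y).
Proof.
have d0 := d_neq0 C n.
rewrite rfun_apply; last by move=> h; exact: y_kx.
under eq_bigr => h _ do rewrite chi0l mul1r /pairf -(mulmxA (W h)).
rewrite -tr_expand /pairf pauli0 !mul1mx /Y mulmxDr mxtraceD -scalemxAr mxtraceZ.
have -> : \tr (X *m (W c *m X)) = \tr (W c *m (X *m X)).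
  by rewrite mxtrace_mulC mulmxA.
by field.
Qed.

Lemma norm_y c g : `|y c g| ^+ 2 = \tr (W g *m X) ^+ 2 * \tr (W (kx g c) *m X) ^+ 2.
Proof.
rewrite normCK pairf_conj // (expr2 (\tr (W (kx g c) *m X))) tr_kx_pair /pairf; ring.
Qed.

Lemma sum_sq_tr (A : 'M[C]_(2 ^ n)) : \sum_(g : K) \tr (W g *m A) ^+ 2 = d * \tr (A *m A).
Proof. by rewrite tr_expand; apply: eq_bigr => g _; rewrite expr2. Qed.

(** The squared modulus factorises over the labels [g] and [g + c], which range independently. *)
Lemma sum_norm_y : \sum_(c : K) \sum_(g : K) `|y c g| ^+ 2 = (d * t2) ^+ 2.
Proof.
rewrite exchange_big /= expr2 -{1}sum_sq_tr mulr_suml; apply: eq_bigr => g _.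
rewrite -sum_sq_tr mulr_sumr [RHS](reindex (kx g)) /=; last by exists (kx g) => x _; exact: kKx.
by apply: eq_bigr => c _; exact: norm_y.
Qed.

Lemma adj_Y : adj Y = Y.
Proof.
by rewrite /Y adj_mxD adj_mxZ adj_mxM hX -tr_adj hX.
Qed.

(** A common upper bound for [lam1] and [lam2]. *)
Definition lamM : C := d * (1 + theta z) / ((d + 2) * (d + 1) ^+ 2).

Local Notation th := (theta z).

Lemma lam0_ge0 : 0 <= lam0 z.
Proof.
rewrite /lam0; move: (theta z) (theta_ge0 hn hz hs) => t t0.
by rewrite divr_ge0 ?mulr_ge0 ?addr_ge0 ?ler0n ?ler01.
Qed.

Lemma mu1_ge0 : 0 <= mu1 z.
Proof.
have h1 : 0 <= d + 2 - th.
  by rewrite -addrA addr_ge0 ?ler0n // subr_ge0 (le_trans (theta_le1 hn hz hs)) // ler1n.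
rewrite /mu1; move: (d + 2 - th) h1 => a h1.
by rewrite divr_ge0 ?mulr_ge0 ?exprn_ge0 ?addr_ge0 ?ler0n ?ler01.
Qed.

Lemma lam1_bounds : 0 <= lam1 z <= lamM.
Proof.
have n4 := dD_neq0 C n 4; have n2 := dD_neq0 C n 2; have n1 := dD_neq0 C n 1.
rewrite /lam1 /lamM; move: (theta z) (theta_ge0 hn hz hs) => t t0; apply/andP; split.
  by rewrite divr_ge0 ?mulr_ge0 ?exprn_ge0 ?addr_ge0 ?mulr_ge0 ?addr_ge0 ?ler0n ?ler01.
rewrite -subr_ge0.
have -> : d * (1 + t) / ((d + 2) * (d + 1) ^+ 2)
    - d * (d + t * (d + 2)) / ((d + 4) * (d + 2) * (d + 1) ^+ 2)
    = d * (4 + 2 * t) / ((d + 4) * (d + 2) * (d + 1) ^+ 2).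
  by move: n4 n2 n1; move: d => D /= n4 n2 n1; field; rewrite n4 n2 n1.
by rewrite divr_ge0 ?mulr_ge0 ?exprn_ge0 ?addr_ge0 ?mulr_ge0 ?ler0n ?ler01.
Qed.

Lemma lam2_bounds : 0 <= lam2 z <= lamM.
Proof.
rewrite /lam2 /lamM [_ * d]mulrC.
move: (theta z) (theta_ge0 hn hz hs) (theta_le1 hn hz hs) => t t0 t1; apply/andP; split.
  by rewrite divr_ge0 ?mulr_ge0 ?subr_ge0 ?exprn_ge0 ?addr_ge0 ?ler0n ?ler01.
rewrite ler_wpM2r ?invr_ge0 ?mulr_ge0 ?exprn_ge0 ?addr_ge0 ?ler0n ?ler01 //.
by rewrite ler_wpM2l ?ler0n // lerD2l (le_trans _ t0) // oppr_le0.
Qed.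

Lemma fourth_moment_le : d ^+ 4 * avg (fun P => \tr (P *m X) ^+ 4) <=
  4 * lam0 z * (\sum_(g : K) \tr (W g *m X) ^+ 4) + 4 * mu0 z * (t1 ^+ 2 + t2) ^+ 2
  + 4 * lamM * (d * t2) ^+ 2 + 4 * mu1 z * (d * \tr (Y *m Y)).
Proof.
rewrite avg_fourth (bigD1 k0) //= -(addrA (_ + _)); apply: lerD.
  have -> : \sum_(g : K) \sum_(h : K) (y k0 g)^* * y k0 h * cov k0 g h =
     \sum_(g : K) \sum_(h : K) (y k0 g)^* * y k0 h * ((if chi k0 g == 1 then lam0 z else lam0 z) * rfun k0 g h)
   + mu0 z * (\sum_(g : K) \sum_(h : K) (y k0 g)^* * y k0 h * (rfun k0 k0 g * rfun k0 k0 h)).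
    rewrite mulr_sumr -big_split; apply: eq_bigr => g _ /=.
    rewrite mulr_sumr -big_split; apply: eq_bigr => h _ /=.
    by rewrite (cov0E hn hz hs) if_same; ring.
  apply: lerD.
    have := @rfun_class_form_le C n k0 (y k0) (lam0 z) (lam0 z) (lam0 z) (y_kx k0).
    rewrite lam0_ge0 lexx => /(_ isT isT) h; apply: (le_trans h).
    rewrite le_eqVlt; apply/orP; left; apply/eqP; congr (_ * _).
    by apply: eq_bigr => g _; rewrite norm_y kx0 -exprD.
  rewrite rank1_form; last by move=> h; exact: rfun_conj.
  rewrite rfun_y pauli0 mul1mx /Y mxtraceD mxtraceZ -expr2.
  have re : (t1 ^+ 2 + t2)^* = t1 ^+ 2 + t2.
    by rewrite rmorphD rmorphXn /= -!tr_adj adj_mxM !hX.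
  rewrite le_eqVlt; apply/orP; left; apply/eqP.
  by rewrite normCK rmorphM /= re conjC_nat; ring.
apply: (@le_trans _ _ (\sum_(c : K) (4 * lamM * (\sum_(g : K) `|y c g| ^+ 2)
     + mu1 z * `|2 * \tr (W c *m Y)| ^+ 2))); last first.
  rewrite big_split /= -!mulr_sumr sum_norm_y lerD2l le_eqVlt; apply/orP; left; apply/eqP.
  rewrite -sum_sq_tr [4 * _]mulrC -[RHS]mulrA; congr (mu1 z * _).
  rewrite mulr_sumr; apply: eq_bigr => c _.
  have /eqP re : (\tr (W c *m Y))^* == \tr (W c *m Y) by rewrite tr_pauli_conj // adj_Y.
  by rewrite normCK rmorphM /= re conjC_nat; ring.
have lM0 : 0 <= lamM by case/andP: lam1_bounds; exact: le_trans.
have pos c : 0 <= 4 * lamM * (\sum_(g : K) `|y c g| ^+ 2) + mu1 z * `|2 * \tr (W c *m Y)| ^+ 2.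
  move: (lamM) lM0 (mu1 z) mu1_ge0 => l l0 m m0; apply: addr_ge0; last first.
    by rewrite mulr_ge0 // exprn_ge0.
  rewrite mulr_ge0 // ?mulr_ge0 ?ler0n // sumr_ge0 // => g _.
  by rewrite exprn_ge0.
(* The sum on the right also contains [c = k0]; that term is nonnegative and has no counterpart on
   the left. *)
rewrite [leRHS](bigD1 k0) //= -[leLHS]add0r lerD ?pos //.
apply: ler_sum => c c0.
have -> : \sum_(g : K) \sum_(h : K) (y c g)^* * y c h * cov c g h =
     \sum_(g : K) \sum_(h : K) (y c g)^* * y c h * ((if chi c g == 1 then lam1 z else lam2 z) * rfun c g h)
   + mu1 z * (\sum_(g : K) \sum_(h : K) (y c g)^* * y c h * (rfun c k0 g * rfun c k0 h)).
  rewrite mulr_sumr -big_split; apply: eq_bigr => g _ /=.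
  rewrite mulr_sumr -big_split; apply: eq_bigr => h _ /=.
  by rewrite (covcE hn hz hs) // /lamc; ring.
rewrite rank1_form; last by move=> h; exact: rfun_conj.
rewrite rfun_y lerD2r.
exact: (rfun_class_form_le (y_kx c) lam1_bounds lam2_bounds).
Qed.

End Moments.

(** * Diagonalisation of Hermitian matrices and Schatten norms *)

Section HermitianSpectrum.
Variables (C : numClosedFieldType) (m : nat).

Lemma char_poly_conj (P A : 'M[C]_m) : adj P *m P = 1%:M ->
  char_poly (adj P *m A *m P) = char_poly A.
Proof.
move=> hP; rewrite /char_poly.
have hp : map_mx polyC (adj P) *m map_mx polyC P = 1%:M :> 'M[{poly C}]_m.
  by rewrite -map_mxM hP map_mx1.
have -> : char_poly_mx (adj P *m A *m P)
    = map_mx polyC (adj P) *m char_poly_mx A *m map_mx polyC P.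
  rewrite /char_poly_mx !map_mxM mulmxBr mulmxBl; congr (_ - _).
  by rewrite mul_mx_scalar -scalemxAl hp scalemx1.
by rewrite !det_mulmx mulrAC -det_mulmx hp det1 mul1r.
Qed.

Variable X : 'M[C]_m.
Hypothesis hX : adj X = X.

Lemma hermitian_diagonalise : exists (P : 'M[C]_m) (sp : 'I_m -> C),
  [/\ P *m adj P = 1%:M, adj P *m P = 1%:M, forall i, sp i \is Num.real
    & X = adj P *m diag_mx (\row_i sp i) *m P].
Proof.
have tE (A : 'M[C]_m) : map_mx Num.conj A^T = adj A by rewrite /adj map_trmx.
have nX : X \is normalmx by apply/normalmxP; rewrite tE hX.
have /unitarymxP := spectral_unitarymx X; rewrite tE.
have /orthomx_spectralP := nX; rewrite invmx_unitary ?spectral_unitarymx // tE.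
move: (spectralmx X) (spectral_diag X) => P D eX P1.
have P2 : adj P *m P = 1%:M by exact: mulmx1C.
exists P, (fun i => D 0 i); rewrite (_ : \row_i D 0 i = D); last first.
  by apply/rowP => i; rewrite mxE.
split=> // i.
have eD : diag_mx D = P *m X *m adj P.
  by rewrite eX !mulmxA P1 mul1mx -mulmxA P1 mulmx1.
have : adj (diag_mx D) = diag_mx D by rewrite eD !adj_mxM adj_mxK hX mulmxA.
by move/matrixP/(_ i i); rewrite !mxE eqxx !mulr1n CrealE => /eqP.
Qed.

Variables (P : 'M[C]_m) (sp : 'I_m -> C).
Hypotheses (P1 : P *m adj P = 1%:M) (P2 : adj P *m P = 1%:M).
Hypothesis sp_real : forall i, sp i \is Num.real.
Hypothesis eX : X = adj P *m diag_mx (\row_i sp i) *m P.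

(** Functional calculus in a fixed eigenbasis, with functions given on eigenvalue indices. *)
Definition fcalc (f : 'I_m -> C) : 'M[C]_m := adj P *m diag_mx (\row_i f i) *m P.

Lemma fcalcM f g : fcalc f *m fcalc g = fcalc (fun i => f i * g i).
Proof.
rewrite /fcalc !mulmxA; congr (_ *m _); rewrite -(mulmxA _ P) P1 mulmx1 -mulmxA.
congr (_ *m _); rewrite mulmx_diag; congr diag_mx.
by apply/rowP => i; rewrite !mxE.
Qed.

Lemma fcalcD f g : fcalc f + fcalc g = fcalc (fun i => f i + g i).
Proof.
rewrite /fcalc -mulmxDl -mulmxDr -raddfD; congr (_ *m diag_mx _ *m _).
by apply/rowP => i; rewrite !mxE.
Qed.

Lemma fcalcZ a f : a *: fcalc f = fcalc (fun i => a * f i).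
Proof.
rewrite /fcalc scalemxAl scalemxAr -linearZ /=; congr (_ *m diag_mx _ *m _).
by apply/rowP => i; rewrite !mxE.
Qed.

Lemma tr_fcalc f : \tr (fcalc f) = \sum_i f i.
Proof.
rewrite /fcalc mxtrace_mulC mulmxA P1 mul1mx mxtrace_diag.
by apply: eq_bigr => i _; rewrite mxE.
Qed.

(** [eigenvalues] is a list of roots in unspecified order, so the two lists are compared through
    their products of linear factors. *)
Lemma eigenvalues_XX : perm_eq (eigenvalues (adj X *m X)) [seq sp i ^+ 2 | i <- enum 'I_m].
Proof.
rewrite /eigenvalues; case: closed_field_poly_normal => r /= e.
apply: prod_XsubC_eq; move: e; rewrite (monicP (char_poly_monic _)) scale1r => <-.
have -> : adj X *m X = fcalc (fun i => sp i * sp i) by rewrite hX eX; exact: fcalcM.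
rewrite char_poly_conj // char_poly_trig ?diag_mx_is_trig // big_map big_enum /=.
by apply: eq_bigr => i _; rewrite !mxE eqxx mulr1n expr2.
Qed.

Lemma schatten1E : schatten1 X = \sum_i `|sp i|.
Proof.
rewrite /schatten1 /singular_values big_map (perm_big _ eigenvalues_XX) /= big_map big_enum /=.
by apply: eq_bigr => i _; rewrite -real_normK // sqrCK.
Qed.

Lemma schatten2_sq : schatten2 X ^+ 2 = \tr (X *m X).
Proof.
rewrite /schatten2 sqrtCK /singular_values big_map (perm_big _ eigenvalues_XX) /=.
rewrite big_map big_enum /= {1 2}eX (fcalcM sp sp) tr_fcalc.
by apply: eq_bigr => i _; rewrite sqrtCK expr2.
Qed.

Lemma unitary_diag_le1 (V : 'M[C]_m) i : V *m adj V = 1%:M -> `|V i i| <= 1.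
Proof.
move=> hV; have : \sum_j `|V i j| ^+ 2 = 1.
  have /matrixP/(_ i i) := hV; rewrite !mxE eqxx mulr1n => <-.
  by apply: eq_bigr => j _; rewrite !mxE normCK.
rewrite (bigD1 i) //= => e.
rewrite -(@ler_pXn2r _ 2) ?nnegrE // expr1n -e lerDl sumr_ge0 // => j _.
by rewrite exprn_ge0.
Qed.

(** In the eigenbasis the trace is the sum of the eigenvalues weighted by diagonal entries of a
    unitary, which have modulus at most 1. *)
Lemma tr_unitary_le (V : 'M[C]_m) : V *m adj V = 1%:M -> `|\tr (V *m X)| <= \sum_i `|sp i|.
Proof.
move=> hV; pose V' := P *m V *m adj P.
have hV' : V' *m adj V' = 1%:M.
  by rewrite /V' !adj_mxM adj_mxK !mulmxA -(mulmxA (P *m V)) P2 mulmx1 -(mulmxA P) hV mulmx1 P1.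
have -> : \tr (V *m X) = \tr (V' *m diag_mx (\row_i sp i)).
  by rewrite eX !mulmxA mxtrace_mulC !mulmxA.
clearbody V'; rewrite mul_mx_diag; apply: le_trans (ler_norm_sum _ _ _) _.
apply: ler_sum => i _; rewrite !mxE.
by rewrite normrM ler_piMl // unitary_diag_le1.
Qed.

End HermitianSpectrum.

(** * The scalar inequalities *)

Section FinalEstimate.
Variable F : numFieldType.
Implicit Types D th r S T : F.

Ltac nneg := repeat (first [ done | apply: addr_ge0 | apply: mulr_ge0 | apply: exprn_ge0
  | rewrite invr_ge0 | by rewrite ler0n | by rewrite ler01 ]).

(** [D], [th], [r], [S], [T] stand for d, theta, r_eff(X), tr(X^2), (tr X)^2. The left side is
    [fourth_moment_le] with its traces estimated; the last factor on the right is (T + S)^3 / S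
    without its term T^3 / S. *)
Lemma moment_poly_le D th r S T :
  2 <= D -> 0 <= th -> th <= 1 -> 1 <= r -> 0 <= S -> 0 <= T ->
  4 * (th * D / (2 * (D + 1) * (D + 2))) * (D * r * S ^+ 2)
  + 4 * (D ^+ 2 * (D + 2 - th) / (4 * (D + 2) * (D + 1) ^+ 2)) * (T + S) ^+ 2
  + 4 * (D * (1 + th) / ((D + 2) * (D + 1) ^+ 2)) * (D * S) ^+ 2
  + 4 * (D ^+ 2 * (D + 2 - th) / ((D + 4) * (D + 2) * (D + 1) ^+ 2))
      * (D * (5 * T * S + 5 / 4 * S ^+ 2))
  <= (6 * ((2 + th * (D - 1)) / (D + 1)) * r + 10) * (D / (D + 1)) ^+ 3
      * (S ^+ 2 + 3 * T * S + 3 * T ^+ 2).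
Proof.
move=> D2 th0 th1 r1 S0 T0; rewrite -subr_ge0.
(* In these variables the hypotheses are plain nonnegativity. With [u + th = 1], the difference
   becomes a quadratic form in [S] and [T] whose coefficients are built from [k] and the polynomials
   [G], [H], [I], which have nonnegative coefficients. *)
pose e := D - 2; pose u := 1 - th; pose rho := r - 1.
have e0 : 0 <= e by rewrite subr_ge0.
have u0 : 0 <= u by rewrite subr_ge0.
have rho0 : 0 <= rho by rewrite subr_ge0.
have D0 : 0 < D by rewrite (lt_le_trans _ D2).
have n1 : D + 1 != 0 by rewrite lt0r_neq0 // addr_gt0.
have n2 : D + 2 != 0 by rewrite lt0r_neq0 // addr_gt0 // ltr0n.
have n4 : D + 4 != 0 by rewrite lt0r_neq0 // addr_gt0 // ltr0n.
pose G := (1008 + 1008 * e + 310 * e ^+ 2 + 30 * e ^+ 3) * u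
  + (684 + 756 * e + 260 * e ^+ 2 + 28 * e ^+ 3) * th
  + rho * ((576 + 528 * e + 144 * e ^+ 2 + 12 * e ^+ 3) * u
     + (540 + 702 * e + 318 * e ^+ 2 + 60 * e ^+ 3 + 4 * e ^+ 4) * th).
pose H := (816 + 692 * e + 154 * e ^+ 2 + 8 * e ^+ 3) * u
  + (972 + 810 * e + 176 * e ^+ 2 + 8 * e ^+ 3) * th.
pose I := (228 + 173 * e + 29 * e ^+ 2) * u + (231 + 174 * e + 29 * e ^+ 2) * th.
pose k := 6 * ((2 + th * (1 + e)) / (D + 1)) * r * (D / (D + 1)) ^+ 3.
set x := (X in 0 <= X).
have -> : x = D ^+ 2 / ((D + 1) ^+ 4 * (D + 2) * (D + 4)) * (G * S ^+ 2)
   + (3 * k + D ^+ 2 / ((D + 1) ^+ 3 * (D + 2) * (D + 4)) * H) * (T * S)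
   + (3 * k + D ^+ 2 / ((D + 1) ^+ 3 * (D + 2)) * I) * T ^+ 2.
  rewrite /x /k /G /H /I /e /u /rho; field.
  by rewrite n1 n2 n4.
have D0' := ltW D0; have r0 : 0 <= r by rewrite (le_trans _ r1).
have k0 : 0 <= k.
  by rewrite /k; nneg.
have G0 : 0 <= G by rewrite /G; nneg.
have H0 : 0 <= H by rewrite /H; nneg.
have I0 : 0 <= I by rewrite /I; nneg.
move: k G H I k0 G0 H0 I0 {x} => k G H I k0 G0 H0 I0.
by nneg.
Qed.

(* The tangent inequality u >= (3 u^2 - u^4) / 2 behind Berger's moment inequality. *)
Lemma berger_pointwise (x t : F) : x \is Num.real -> 0 < t ->
  (3 * x ^+ 2 / t - x ^+ 4 / t ^+ 3) / 2 <= `|x|.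
Proof.
move=> xr t0; rewrite -subr_ge0.
have -> : x ^+ 4 = `|x| ^+ 4 by rewrite (exprM x 2 2) -(real_normK xr) -exprM.
rewrite -(real_normK xr); move: `|x| (normr_ge0 x) => u u0.
have -> : u - (3 * u ^+ 2 / t - u ^+ 4 / t ^+ 3) / 2
    = u * (u - t) ^+ 2 * (u + 2 * t) / (2 * t ^+ 3).
  by field; rewrite lt0r_neq0.
have t0' := ltW t0.
have ut : 0 <= (u - t) ^+ 2.
  by apply: real_exprn_even_ge0 => //; apply: rpredB; exact: ger0_real.
by nneg.
Qed.

End FinalEstimate.

(** * Finiteness of the Clifford orbit *)

Section OrbitFinite.
Variables (C : numClosedFieldType) (n : nat) (z : 'cV[C]_(2 ^ n)).
Local Notation K := {ffun 'I_n -> 'I_4}.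
Local Notation d := ((2 ^ n)%:R : C).
Local Notation W := (@pauli C n).

(** The Pauli expansion of [proj z] with each [W k] replaced by a phased Pauli. The possible
    replacements [F] form a finite type, and every orbit point arises from one of them. *)
Definition pauli_image (F : {ffun K -> 'I_4 * K}) : 'M[C]_(2 ^ n) :=
  d^-1 *: \sum_(k : K) \tr (W k *m proj z) *: ('i ^+ (F k).1 *: W (F k).2).

Lemma unit4_pow (c : C) : c ^+ 4 = 1 -> exists j : 'I_4, c = 'i ^+ j.
Proof.
move/unit4P => [->|[->|[->|->]]].
- by exists ord0; rewrite expr0.
- by exists (inord 2); rewrite inordK // sqrCi.
- by exists (inord 1); rewrite inordK // expr1.
- by exists (inord 3); rewrite inordK // exprS sqrCi mulrN1.
Qed.

Lemma orbit_pauli_image U : clifford U ->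
  exists F, U *m proj z *m adj U = pauli_image F.
Proof.
case/clifford_images => pi [cc h].
have h' k : exists j : 'I_4, cc k = 'i ^+ j by apply: unit4_pow; case: (h k).
have [j hj] := fin_all_exists h'.
exists [ffun k => (j k, pi k)].
have d0 := d_neq0 C n; apply: (scalerI d0).
rewrite /pauli_image scalerA divff // scale1r scalemxAl scalemxAr -pauli_expand.
rewrite mulmx_sumr mulmx_suml; apply: eq_bigr => k _.
by rewrite -scalemxAr -scalemxAl (h k).2 ffunE /= -hj.
Qed.

(** The finitely many candidates are filtered by membership in the orbit, a proposition made boolean
    by classical logic. *)
Lemma orbit_enum_exists : exists s, clifford_orbit_enum z s.
Proof.
pose inO P := boolp.asbool (exists U, clifford U /\ P = U *m proj z *m adj U).
exists (undup [seq P <- codom pauli_image | inO P]); split; first exact: undup_uniq.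
move=> P; rewrite mem_undup mem_filter; split; first by case/andP=> /boolp.asboolP.
move=> hP; apply/andP; split; first exact/boolp.asboolP.
case: hP => U [hU ->]; have [F ->] := orbit_pauli_image hU; exact: codom_f.
Qed.

End OrbitFinite.

(** * Assembly of the lower bound *)

Section LowerBound.
Variables (C : numClosedFieldType) (n : nat).
Local Notation K := {ffun 'I_n -> 'I_4}.
Local Notation d := ((2 ^ n)%:R : C).
Local Notation W := (@pauli C n).
Variables (z : 'cV[C]_(2 ^ n)) (s : seq 'M[C]_(2 ^ n)).
Hypothesis hn : (1 <= n)%N.
Hypothesis hz : adj z *m z = 1%:M.
Hypothesis hs : clifford_orbit_enum z s.
Variable X : 'M[C]_(2 ^ n).
Hypothesis hX : adj X = X.
Hypothesis X0 : X != 0.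
Local Notation avg := (avg s).
Local Notation t1 := (\tr X).
Local Notation t2 := (\tr (X *m X)).

Lemma povm_l1E : povm_l1 s X = d * avg (fun P => `|\tr (P *m X)|).
Proof.
rewrite /povm_l1 /avg mulrA mulr_sumr; apply: eq_bigr => P _.
by rewrite -scalemxAl mxtraceZ normrM ger0_norm // divr_ge0 ?ler0n.
Qed.

Lemma d_alphaE : d * alpha z = (2 + theta z * (d - 1)) / (d + 1).
Proof.
rewrite /theta; have := d1_neq0 C hn; have /= := dD_neq0 C n 1.
by move: d (alpha z) => D a h1 h2; field; rewrite h1 h2.
Qed.

Lemma d_alpha_ge0 : 0 <= d * alpha z.
Proof.
have d1 : 0 <= d - 1 by rewrite subr_ge0 (le_trans _ (d_ge2 C hn)) // ler1n.
rewrite d_alphaE; move: (theta z) (theta_ge0 hn hz hs) => th th0.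
apply: divr_ge0; apply: addr_ge0; rewrite ?ler0n ?ler01 //; exact: mulr_ge0.
Qed.

Lemma hermitian_trace_bounds : [/\ 0 < t2, t2 <= schatten1 X ^+ 2, r_eff X = schatten1 X ^+ 2 / t2,
   0 < schatten1 X & t1 \is Num.real /\
   (forall g, \tr (W g *m X) ^+ 2 <= schatten1 X ^+ 2) /\
   \tr (trX_mul_X_plus_X2 X *m trX_mul_X_plus_X2 X) <= 5 * t1 ^+ 2 * t2 + 5 / 4 * t2 ^+ 2].
Proof.
have [P [sp [P1 P2 sp_real eX]]] := hermitian_diagonalise hX.
have s1 := schatten1E hX P1 P2 sp_real eX.
have s2 := schatten2_sq hX P1 P2 eX.
have XE : X = fcalc P sp by [].
have t1E : t1 = \sum_i sp i by rewrite {1}XE tr_fcalc.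
have t2E : t2 = \sum_i sp i ^+ 2.
  by rewrite {1 2}XE fcalcM // tr_fcalc //; apply: eq_bigr => i _; rewrite expr2.
have sq0 i : 0 <= sp i ^+ 2 by exact: real_exprn_even_ge0.
have T0 : 0 <= schatten1 X by rewrite s1 sumr_ge0.
have t2_gt0 : 0 < t2.
  rewrite lt_def t2E sumr_ge0 // andbT; apply: contraNneq X0 => /eqP.
  rewrite psumr_eq0 // => /allP h; rewrite XE /fcalc (_ : \row_i sp i = 0) ?linear0 ?mulmx0 ?mul0mx //.
  apply/rowP => i; rewrite !mxE; apply/eqP.
  by have := h i (mem_index_enum i); rewrite /= sqrf_eq0.
have sq_sum (u : 'I_(2 ^ n) -> C) : (forall i, 0 <= u i) ->
    \sum_i u i ^+ 2 <= (\sum_i u i) ^+ 2.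
  move=> u0; rewrite [leRHS]expr2 mulr_suml; apply: ler_sum => i _.
  by rewrite expr2 ler_wpM2l // (bigD1 i) //= lerDl sumr_ge0.
have t2le : t2 <= schatten1 X ^+ 2.
  rewrite t2E s1; apply: le_trans (sq_sum _ (fun i => normr_ge0 (sp i))).
  by apply: ler_sum => i _; rewrite real_normK.
have t1r : t1 \is Num.real by rewrite t1E rpred_sum.
split=> //.
- by rewrite /r_eff s2.
- rewrite lt_def T0 andbT; apply: contraTneq (lt_le_trans t2_gt0 t2le) => ->.
  by rewrite expr0n ltxx.
split=> //; split=> [g|].
  have gr : \tr (W g *m X) \is Num.real by rewrite CrealE tr_pauli_conj.
  rewrite -(real_normK gr) ler_pXn2r ?nnegrE // s1.
  by apply: (tr_unitary_le P1 P2 eX); rewrite adj_pauli pauli_sq.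
rewrite /trX_mul_X_plus_X2.
have -> : t1 *: X + X *m X = fcalc P (fun i => t1 * sp i + sp i * sp i).
  by move: t1 => a; rewrite {1 2 3}XE fcalcZ fcalcM // fcalcD.
rewrite fcalcM // tr_fcalc //.
apply: (@le_trans _ _ (\sum_i (5 * t1 ^+ 2 * sp i ^+ 2 + 5 / 4 * (sp i ^+ 2) ^+ 2))).
  apply: ler_sum => i _; rewrite -subr_ge0.
  (* The weighted inequality (a + b)^2 <= 5 a^2 + (5/4) b^2, whose gap is (2 a - b/2)^2. *)
  have -> : 5 * t1 ^+ 2 * sp i ^+ 2 + 5 / 4 * (sp i ^+ 2) ^+ 2
     - (t1 * sp i + sp i * sp i) * (t1 * sp i + sp i * sp i)
     = (2 * t1 * sp i - sp i ^+ 2 / 2) ^+ 2 by field.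
  apply: real_exprn_even_ge0 => //.
  by rewrite rpredB // ?rpredM ?rpredV ?rpredX // realn.
rewrite big_split /= -!mulr_sumr -t2E lerD2l ler_wpM2l ?divr_ge0 ?ler0n //.
by rewrite t2E sq_sum.
Qed.

Local Notation r := (r_eff X).
Local Notation kappa := (6 * d * alpha z * r + 10).
Local Notation m2 := ((t1 ^+ 2 + t2) / (d * (d + 1))).

Lemma avg_fourth_le : avg (fun P => \tr (P *m X) ^+ 4) <= kappa * m2 ^+ 3 * d ^+ 2 / t2.
Proof.
have [t2_gt0 t2le rE T0 [t1r [trW trY]]] := hermitian_trace_bounds.
have dp := d_gt0 C n; have d0 := d_neq0 C n.
have n1 := dD_neq0 C n 1.
have r1 : 1 <= r by rewrite rE ler_pdivlMr // mul1r.
have tau0 : 0 <= t1 ^+ 2 by exact: real_exprn_even_ge0.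
rewrite -(ler_pM2l (exprn_gt0 4 dp)).
apply: le_trans (fourth_moment_le hn hz hs hX) _.
(* Two of the four factors are bounded by [schatten1 X]; the remaining squares sum to [d] times
   tr(X^2). *)
have q4 : \sum_(g : K) \tr (W g *m X) ^+ 4 <= d * r * t2 ^+ 2.
  have -> : d * r * t2 ^+ 2 = schatten1 X ^+ 2 * (d * t2).
    by rewrite rE; field; exact: lt0r_neq0.
  rewrite -sum_sq_tr mulr_sumr; apply: ler_sum => g _.
  rewrite (exprM _ 2 2) [leLHS]expr2 ler_wpM2r //.
  by apply: real_exprn_even_ge0 => //; rewrite CrealE tr_pauli_conj.
have l0 := lam0_ge0 hn hz hs; have m0 := mu1_ge0 hn hz hs.
have q4' := ler_wpM2l (mulr_ge0 (ler0n C 4) l0) q4.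
have trY' := ler_wpM2l (mulr_ge0 (ler0n C 4) m0) (ler_wpM2l (ltW dp) trY).
apply: le_trans (lerD (lerD (lerD q4' (lexx _)) (lexx _)) trY') _.
have := moment_poly_le (d_ge2 C hn) (theta_ge0 hn hz hs) (theta_le1 hn hz hs) r1 (ltW t2_gt0) tau0.
rewrite -d_alphaE => h; apply: le_trans h _.
have -> : d ^+ 4 * (kappa * m2 ^+ 3 * d ^+ 2 / t2)
    = (6 * (d * alpha z) * r + 10) * (d / (d + 1)) ^+ 3 * ((t1 ^+ 2 + t2) ^+ 3 / t2).
  move: (lt0r_neq0 t2_gt0) d0 n1; move: t2 d (alpha z) r (t1 ^+ 2) => S D a R T S0 D0 n1.
  by field; rewrite S0 D0 n1.
have r0 : 0 <= r by rewrite (le_trans _ r1).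
have k0 : 0 <= 6 * (d * alpha z) * r + 10.
  by rewrite addr_ge0 ?ler0n // mulr_ge0 // mulr_ge0 ?ler0n // d_alpha_ge0.
apply: ler_wpM2l; first by rewrite mulr_ge0 // exprn_ge0 // divr_ge0 // ?addr_ge0 // ltW.
(* The gap is the cube of (tr X)^2, the term of the binomial expansion left out in
   [moment_poly_le]. *)
rewrite ler_pdivlMr // -subr_ge0.
have -> : (t1 ^+ 2 + t2) ^+ 3 - (t2 ^+ 2 + 3 * t1 ^+ 2 * t2 + 3 * (t1 ^+ 2) ^+ 2) * t2
   = (t1 ^+ 2) ^+ 3 by ring.
by rewrite exprn_ge0.
Qed.

Lemma povm_lower_bound : schatten1 X / sqrtC (kappa * r) <= povm_l1 s X.
Proof.
have [t2_gt0 t2le rE T0 [t1r _]] := hermitian_trace_bounds.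
have dp := d_gt0 C n.
have r1 : 1 <= r by rewrite rE ler_pdivlMr // mul1r.
have r0 : 0 < r by rewrite (lt_le_trans _ r1).
have m2_gt0 : 0 < m2.
  apply: divr_gt0; last by rewrite mulr_gt0 // addr_gt0.
  by rewrite ltr_wpDl // real_exprn_even_ge0.
have k0 : 0 < kappa.
  rewrite -(mulrA 6) ltr_wpDl ?ltr0n // mulr_ge0 ?(ltW r0) //.
  by rewrite mulr_ge0 ?ler0n // d_alpha_ge0.
have q0 : 0 < sqrtC (kappa * r) by rewrite sqrtC_gt0 mulr_gt0.
have q2 : sqrtC (kappa * r) ^+ 2 = kappa * r by rewrite sqrtCK.
move: (sqrtC (kappa * r)) q0 q2 => q q0 q2.
(* The tangent point is chosen so that [m2 * t ^+ 2] is exactly the bound of [avg_fourth_le].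
   Averaging [berger_pointwise] then yields at least (3 m2/t - m2/t)/2 = m2/t, which is the claimed
   bound divided by [d]. *)
pose t := d * m2 * q / schatten1 X.
have t0 : 0 < t by apply: divr_gt0 => //; apply: mulr_gt0 => //; exact: mulr_gt0.
have -> : schatten1 X / q = d * (m2 / t).
  have aux (T Q M D : C) : T != 0 -> Q != 0 -> M != 0 -> D != 0 ->
      T / Q = D * (M / (D * M * Q / T)).
    by move=> T1 Q1 M1 D1; field; rewrite T1 Q1 M1 D1.
  by apply: aux; exact: lt0r_neq0.
rewrite povm_l1E ler_pM2l //.
have bp : avg (fun P => (3 * \tr (P *m X) ^+ 2 / t - \tr (P *m X) ^+ 4 / t ^+ 3) / 2)
    <= avg (fun P => `|\tr (P *m X)|).
  rewrite -subr_ge0 -mulN1r -avgZ -avgD; apply: (avg_ge0 hz hs) => P pP.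
  rewrite mulN1r subr_ge0; apply: berger_pointwise => //.
  by rewrite CrealE tr_PX_real.
apply: le_trans bp.
have -> : avg (fun P => (3 * \tr (P *m X) ^+ 2 / t - \tr (P *m X) ^+ 4 / t ^+ 3) / 2)
   = 3 / t / 2 * m2 + - (t ^+ 3)^-1 / 2 * avg (fun P => \tr (P *m X) ^+ 4).
  rewrite -(avg_sqr_tr hn hz hs hX) -!avgZ -avgD; apply: avg_ext => P.
  by field; exact: lt0r_neq0.
have m4 : avg (fun P => \tr (P *m X) ^+ 4) <= m2 * t ^+ 2.
  apply: le_trans avg_fourth_le _; rewrite le_eqVlt; apply/orP; left; apply/eqP.
  have tt : t ^+ 2 = d ^+ 2 * m2 ^+ 2 * (kappa * r) / schatten1 X ^+ 2.
    have aux (D M Q T : C) : (D * M * Q / T) ^+ 2 = D ^+ 2 * M ^+ 2 * Q ^+ 2 / T ^+ 2.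
      by rewrite !exprMn exprVn.
    by rewrite -q2; exact: aux.
  have rT : kappa * r = kappa * schatten1 X ^+ 2 / t2 by rewrite -[RHS]mulrA -rE.
  have aux (M k T S D : C) : T != 0 -> S != 0 ->
      k * M ^+ 3 * D ^+ 2 / S = M * (D ^+ 2 * M ^+ 2 * (k * T ^+ 2 / S) / T ^+ 2).
    by move=> T1 S1; field; rewrite T1 S1.
  by rewrite tt rT; apply: aux; exact: lt0r_neq0.
rewrite -subr_ge0.
have -> : 3 / t / 2 * m2 + - (t ^+ 3)^-1 / 2 * avg (fun P => \tr (P *m X) ^+ 4) - m2 / t
   = (m2 * t ^+ 2 - avg (fun P => \tr (P *m X) ^+ 4)) / (2 * t ^+ 3).
  have aux (u M A : C) : u != 0 ->
      3 / u / 2 * M + - (u ^+ 3)^-1 / 2 * A - M / u = (M * u ^+ 2 - A) / (2 * u ^+ 3).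
    by move=> u0; field.
  by apply: aux; exact: lt0r_neq0.
by rewrite divr_ge0 ?subr_ge0 // mulr_ge0 ?ler0n // exprn_ge0 // ltW.
Qed.

End LowerBound.

(** The first conjunct ensures that the bound, stated for every enumeration of the orbit, is not
    vacuous. *)
Theorem theorem1 (C : numClosedFieldType) (n : nat) (hn : (1 <= n)%N)
    (z : 'cV[C]_(2 ^ n)) (hz : adj z *m z = 1%:M) :
  (exists s, clifford_orbit_enum z s) /\
  forall s, clifford_orbit_enum z s ->
  forall X : 'M[C]_(2 ^ n), adj X = X -> X != 0 ->
    schatten1 X / sqrtC ((6 * (2 ^ n)%:R * alpha z * r_eff X + 10) * r_eff X)
      <= povm_l1 s X.
Proof.
split; first exact: orbit_enum_exists.
by move=> s hs X hX X0; exact: (povm_lower_bound hn hz hs).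
Qed.
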